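(* Consider a sequence of Gaussian linear regression models $\mathbf{y}=X_p\boldsymbol{\beta}_p+\boldsymbol{\epsilon}$, as described in the context, with $r=\mathrm{rank}(X_p)\to\infty$, and let the design be nearly-orthogonal, i.e. the sequence $\tau_p[r]$ is bounded away from zero by some constant $c>0$. 1. As $r$ increases, the asymptotic minimax risk of estimating the mean vector $X_p\boldsymbol{\beta}_p$ over $\mathcal{M}_{p_0}$ is of the order $\min(p_0(\ln(p/p_0)+1),r)$; that is, there exist two constants $0<C_1\le C_2<\infty$ such that for all sufficiently large $r$, $$C_1\,\sigma^2\min\left(p_0(\ln(p/p_0)+1),r\right)\le \inf_{\hat{\mathbf{y}}}\sup_{\boldsymbol{\beta}_p:\|\boldsymbol{\beta}_p\|_0\le p_0}E\|\hat{\mathbf{y}}-X_p\boldsymbol{\beta}_p\|^2\le C_2\,\sigma^2\min\left(p_0(\ln(p/p_0)+1),r\right)$$ for all $1\le p_0\le r$, where the infimum is over all estimates $\hat{\mathbf{y}}$ (measurable functions of $\mathbf{y}$). 2. Let $\gamma>0$ and $c(\gamma)=8(\gamma+3/4)^2$. Assume that the priors $\pi_p$ satisfy $$\pi_p(k)\le \binom{p}{k}e^{-c(\gamma)k},\quad k=0,\dots,r-1,\qquad \pi_p(r)\le e^{-c(\gamma)r},$$ and, in addition, $\pi_p(k)\ge (k/(pe))^{c_1k}$ for $k=1,\dots,r-1$ and $\pi_p(r)\ge e^{-c_2r}$ for some constants $c_1,c_2>c(\gamma)$. Then the corresponding MAP model selector attains the minimax convergence rates simultaneously over all $\mathcal{M}_{p_0}$,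 $1\le p_0\le r$; that is, there is a constant $C<\infty$ (not depending on $n$, $p$, $r$, $p_0$) such that for all sufficiently large $r$ and all $1\le p_0\le r$, $$\sup_{\boldsymbol{\beta}_p:\|\boldsymbol{\beta}_p\|_0\le p_0}E\|X_p\hat{\boldsymbol{\beta}}_{p\hat M}-X_p\boldsymbol{\beta}_p\|^2\le C\inf_{\hat{\mathbf{y}}}\sup_{\boldsymbol{\beta}_p:\|\boldsymbol{\beta}_p\|_0\le p_0}E\|\hat{\mathbf{y}}-X_p\boldsymbol{\beta}_p\|^2 .$$
   Context: Asymptotic setting: the sample size $n$ increases, $p=p_n$ may increase with $n$ (possibly $p>n$), and $X_p=X_{n,p_n}\in\mathbb{R}^{n\times p}$ is a sequence of design matrices with $\mathrm{rank}(X_p)=r=r_n\to\infty$ and any $r$ columns of $X_p$ linearly independent. $\boldsymbol{\beta}_p\in\mathbb{R}^p$, $\boldsymbol{\epsilon}\sim N(\mathbf{0},\sigma^2I_n)$, and the known noise variance $\sigma^2>0$ does not depend on $n$ and $p$. The index $n$ is suppressed. $\|\boldsymbol{\beta}\|_0$ is the number of nonzero entries of $\boldsymbol{\beta}$, $\|\cdot\|$ is the Euclidean norm, $E$ is the expectation with respect to $\boldsymbol{\epsilon}$. For $k=1,\dots,r$, $\tau_p[k]=\phi_{p,min}[k]/\phi_{p,max}[k]$, where $\phi_{p,min}[k]$ and $\phi_{p,max}[k]$ are the minimum and the maximum of $\|X_p\boldsymbol{\beta}\|^2/\|\boldsymbol{\beta}\|^2$ over $\boldsymbol{\beta}\in\mathbb{R}^p$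 with $1\le\|\boldsymbol{\beta}\|_0\le k$. A model $M$ is a subset of the $p$ predictors (columns of $X_p$), with $|M|$ its size; only models with $|M|\le r$ are considered, and all models of size $r$ are identified with a single saturated model. $\mathcal{M}_{p_0}=\{M:|M|\le p_0\}$; risk over $\mathcal{M}_{p_0}$ means supremum over $\boldsymbol{\beta}_p$ with $\|\boldsymbol{\beta}_p\|_0\le p_0$. For a model $M$, $D_M$ is the $p\times p$ diagonal matrix with $j$th diagonal entry $1$ if the $j$th predictor is in $M$ and $0$ otherwise, and $\hat{\boldsymbol{\beta}}_{pM}=(D_MX_p'X_pD_M)^{+}D_MX_p'\mathbf{y}$ is the least squares estimate ($^{+}$ is the generalized inverse). For each $p$, the prior $\pi_p$ is a probability distribution on $\{0,\dots,r\}$ with $\pi_p(k)>0$ for all $k$. The corresponding MAP model selector $\hat M$ (with parameter $\gamma>0$, not depending on $n,p$) is a solution of $\|\mathbf{y}-X_p\hat{\boldsymbol{\beta}}_{pM}\|^2+Pen(|M|)\to\min_M$ with $$Pen(k)=2\sigma^2(1+1/\gamma)\ln\left\{\binom{p}{k}\pi_p(k)^{-1}(1+\gamma)^{k/2}\right\},\quad k=0,\dots,r-1,$$ $$Pen(r)=2\sigma^2(1+1/\gamma)\ln\left\{\pi_p(r)^{-1}(1+\gamma)^{r/2}\right\}.$$ *)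

(* Defs.v *)
From HB Require Import structures.
From mathcomp Require Import all_boot all_order all_algebra.
From mathcomp Require Import all_classical all_reals all_analysis.

Set Implicit Arguments.
Unset Strict Implicit.
Unset Printing Implicit Defensive.

Import Order.TTheory GRing.Theory Num.Theory.
Import numFieldNormedType.Exports.
Local Open Scope classical_set_scope.
Local Open Scope ring_scope.

(* 'M[R]_(m, n) carries the product sigma-algebra, generated by the entries;
   for 'cV[R]_n this is the Borel sigma-algebra of R^n. *)
Definition mx_measurable (R : realType) (m n : nat) : set (set 'M[R]_(m, n)) :=
  <<s \bigcup_(ij in [set: 'I_m * 'I_n])
        preimage_set_system setT (fun A : 'M[R]_(m, n) => A ij.1 ij.2)
          measurable >>.

Lemma mx_measurable0 (R : realType) (m n : nat) : @mx_measurable R m n set0.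
Proof. exact: (@sigma_algebra0 _ setT). Qed.

Lemma mx_measurableC (R : realType) (m n : nat) (A : set 'M[R]_(m, n)) :
  mx_measurable A -> mx_measurable (~` A).
Proof. by move=> mA; rewrite -setTD; exact: sigma_algebraCD. Qed.

Lemma mx_measurable_bigcup (R : realType) (m n : nat)
    (F : (set 'M[R]_(m, n))^nat) :
  (forall i, mx_measurable (F i)) -> mx_measurable (\bigcup_i F i).
Proof. exact: (@sigma_algebra_bigcup _ setT). Qed.

Fact mx_display : measure_display. Proof. exact: default_measure_display. Qed.

HB.instance Definition _ (R : realType) (m n : nat) :=
  @isMeasurable.Build mx_display 'M[R]_(m, n) (@mx_measurable R m n)
    (@mx_measurable0 R m n) (@mx_measurableC R m n)
    (@mx_measurable_bigcup R m n).

(* ||v||^2, Euclidean *)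
Definition normsq (R : realType) (n : nat) (v : 'cV[R]_n) : R :=
  \sum_i v i ord0 ^+ 2.

(* ||v||_0 *)
Definition norm0 (R : realType) (n : nat) (v : 'cV[R]_n) : nat :=
  #|[set i | v i ord0 != 0]%SET|.

(* eps ~ N(0, sigma^2 I_n): the coordinates are measurable and their joint law
   on boxes is the product of the N(0, sigma^2) laws. The second argument of
   normal_prob is the standard deviation. *)
Definition gaussian_noise (R : realType) (d : measure_display)
    (Omega : measurableType d) (P : probability Omega R) (n : nat)
    (sigma : R) (eps : Omega -> 'cV[R]_n) : Prop :=
  measurable_fun [set: Omega] eps /\
  forall A : 'I_n -> set R, (forall i, measurable (A i)) ->
    P [set w | forall i, A i (eps w i ord0)] =
    (\prod_(i < n) normal_prob 0 sigma (A i))%E.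

Definition columns_free (R : realType) (n p : nat) (X : 'M[R]_(n, p)) : Prop :=
  forall f : 'I_(\rank X) -> 'I_p, injective f -> row_free (colsub f X)^T.

Definition rayleigh (R : realType) (n p : nat) (X : 'M[R]_(n, p)) (k : nat) :
    set R :=
  [set normsq (X *m b) / normsq b | b in [set b | (1 <= norm0 b <= k)%N]].

(* Both extrema are attained when 1 <= k and 1 <= p. *)
Definition phi_min (R : realType) (n p : nat) (X : 'M[R]_(n, p)) (k : nat) : R :=
  inf (rayleigh X k).

Definition phi_max (R : realType) (n p : nat) (X : 'M[R]_(n, p)) (k : nat) : R :=
  sup (rayleigh X k).

Definition tau (R : realType) (n p : nat) (X : 'M[R]_(n, p)) (k : nat) : R :=
  phi_min X k / phi_max X k.

(* The estimates are functions of y = X beta + eps; the risk may be +oo. *)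
Definition risk (R : realType) (d : measure_display)
    (Omega : measurableType d) (P : probability Omega R) (n p : nat)
    (eps : Omega -> 'cV[R]_n) (X : 'M[R]_(n, p)) (yhat : 'cV[R]_n -> 'cV[R]_n)
    (beta : 'cV[R]_p) : \bar R :=
  'E_P[fun w => normsq (yhat (X *m beta + eps w) - X *m beta)].

Definition max_risk (R : realType) (d : measure_display)
    (Omega : measurableType d) (P : probability Omega R) (n p : nat)
    (eps : Omega -> 'cV[R]_n) (X : 'M[R]_(n, p)) (p0 : nat)
    (yhat : 'cV[R]_n -> 'cV[R]_n) : \bar R :=
  ereal_sup [set risk P eps X yhat beta | beta in [set b | (norm0 b <= p0)%N]].

Definition minimax_risk (R : realType) (d : measure_display)
    (Omega : measurableType d) (P : probability Omega R) (n p : nat)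
    (eps : Omega -> 'cV[R]_n) (X : 'M[R]_(n, p)) (p0 : nat) : \bar R :=
  ereal_inf [set max_risk P eps X p0 yhat |
    yhat in [set f | measurable_fun [set: 'cV[R]_n] f]].

(* The generalized inverse is the Moore-Penrose inverse. *)
Definition is_pinv (R : realType) (m n : nat)
    (A : 'M[R]_(m, n)) (B : 'M[R]_(n, m)) : Prop :=
  [/\ A *m B *m A = A, B *m A *m B = B,
      (A *m B)^T = A *m B & (B *m A)^T = B *m A].

Definition pinv (R : realType) (m n : nat) (A : 'M[R]_(m, n)) : 'M[R]_(n, m) :=
  xget 0 [set B | is_pinv A B].

Lemma trmx_mul_unit (R : realType) (m n : nat) (A : 'M[R]_(m, n)) :
  row_free A -> A *m A^T \in unitmx.
Proof.
move=> fA; rewrite -row_free_unit -kermx_eq0; apply/rowV0P => v.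
move=> /sub_kermxP vAA; apply/eqP.
suff: v *m A == 0 by rewrite mulmx_free_eq0.
have : (v *m A) *m (v *m A)^T = 0 by rewrite trmx_mul mulmxA -(mulmxA v) vAA mul0mx.
move=> /matrixP/(_ ord0 ord0); rewrite !mxE => /eqP.
rewrite psumr_eq0; last by move=> i _; rewrite !mxE -expr2 sqr_ge0.
move=> /allP h; apply/eqP/rowP => j.
by move: (h j (mem_index_enum j)); rewrite !mxE -expr2 sqrf_eq0 => /eqP ->.
Qed.

Lemma full_rank_pinv (R : realType) (m n r : nat)
    (C : 'M[R]_(m, r)) (F : 'M[R]_(r, n)) : row_full C -> row_free F ->
  is_pinv (C *m F)
    (F^T *m invmx (F *m F^T) *m invmx (C^T *m C) *m C^T).
Proof.
move=> fullC freeF.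
have uF := trmx_mul_unit freeF.
have uC : C^T *m C \in unitmx.
  have := @trmx_mul_unit R _ _ C^T; rewrite trmxK; apply.
  by rewrite /row_free mxrank_tr.
have UT : (invmx (F *m F^T))^T = invmx (F *m F^T).
  by rewrite trmx_inv trmx_mul trmxK.
have VT : (invmx (C^T *m C))^T = invmx (C^T *m C).
  by rewrite trmx_inv trmx_mul trmxK.
set U := invmx (F *m F^T) in UT *; set V := invmx (C^T *m C) in VT *.
have FU : F *m F^T *m U = 1%:M by rewrite mulmxV.
have VC : V *m (C^T *m C) = 1%:M by rewrite mulVmx.
set B := F^T *m U *m V *m C^T.
have AB : C *m F *m B = C *m V *m C^T.
  have -> : C *m F *m B = C *m (F *m F^T *m U) *m V *m C^T.
    by rewrite /B !mulmxA.
  by rewrite FU mulmx1.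
have BA : B *m (C *m F) = F^T *m U *m F.
  have -> : B *m (C *m F) = F^T *m U *m (V *m (C^T *m C)) *m F.
    by rewrite /B !mulmxA.
  by rewrite VC mulmx1.
split.
- rewrite AB.
  have -> : C *m V *m C^T *m (C *m F) = C *m (V *m (C^T *m C)) *m F.
    by rewrite !mulmxA.
  by rewrite VC mulmx1.
- rewrite BA.
  have -> : F^T *m U *m F *m B = F^T *m U *m (F *m F^T *m U) *m V *m C^T.
    by rewrite /B !mulmxA.
  by rewrite FU mulmx1.
- by rewrite AB !trmx_mul trmxK VT mulmxA.
- by rewrite BA !trmx_mul trmxK UT mulmxA.
Qed.

Lemma pinvP (R : realType) (m n : nat) (A : 'M[R]_(m, n)) : is_pinv A (pinv A).
Proof.
have := @full_rank_pinv R _ _ _ (col_base A) (row_base A)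
  (col_base_full A) (row_base_free A).
by rewrite mulmx_base; move=> h; exact: (@xgetPex _ 0 [set B | is_pinv A B] (ex_intro _ _ h)).
Qed.

Definition model_mx (R : realType) (p : nat) (M : {set 'I_p}) : 'M[R]_p :=
  diag_mx (\row_j (j \in M)%:R).

Definition lse (R : realType) (n p : nat) (X : 'M[R]_(n, p)) (M : {set 'I_p})
    (y : 'cV[R]_n) : 'cV[R]_p :=
  pinv (model_mx R M *m X^T *m X *m model_mx R M) *m model_mx R M *m X^T *m y.

Definition prior (R : realType) (r : nat) (pi : nat -> R) : Prop :=
  (forall k, (k <= r)%N -> 0 < pi k) /\ \sum_(k < r.+1) pi k = 1.

Definition Pen (R : realType) (sigma gamma : R) (p r : nat) (pi : nat -> R)
    (k : nat) : R :=
  2 * sigma ^+ 2 * (1 + 1 / gamma) *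
  ln ((if (k < r)%N then 'C(p, k)%:R else 1) *
      (pi k)^-1 * (1 + gamma) `^ (k%:R / 2)).

Definition map_criterion (R : realType) (sigma gamma : R) (n p : nat)
    (X : 'M[R]_(n, p)) (pi : nat -> R) (y : 'cV[R]_n) (M : {set 'I_p}) : R :=
  normsq (y - X *m lse X M y) + Pen sigma gamma p (\rank X) pi #|M|.

Definition fitted (R : realType) (n p : nat) (X : 'M[R]_(n, p))
    (Mhat : 'cV[R]_n -> {set 'I_p}) (y : 'cV[R]_n) : 'cV[R]_n :=
  X *m lse X (Mhat y) y.

(* The saturated model is represented by any M with #|M| = \rank X: when
   columns_free X holds, these all have the same fit and the same criterion.
   Measurability is therefore required of the fit only, so that ties between
   these representatives may be broken arbitrarily. *)
Definition map_selector (R : realType) (sigma gamma : R) (n p : nat)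
    (X : 'M[R]_(n, p)) (pi : nat -> R) (Mhat : 'cV[R]_n -> {set 'I_p}) : Prop :=
  measurable_fun [set: 'cV[R]_n] (fitted X Mhat) /\
  forall y, (#|Mhat y| <= \rank X)%N /\
    forall M : {set 'I_p}, (#|M| <= \rank X)%N ->
      map_criterion sigma gamma X pi y (Mhat y) <=
      map_criterion sigma gamma X pi y M.

Definition c_gamma (R : realType) (gamma : R) : R :=
  8 * (gamma + 3 / 4) ^+ 2.

Definition prior_upper (R : realType) (gamma : R) (p r : nat) (pi : nat -> R) :
    Prop :=
  (forall k, (k < r)%N -> pi k <= 'C(p, k)%:R * expR (- (c_gamma gamma * k%:R)))
  /\ pi r <= expR (- (c_gamma gamma * r%:R)).

Definition prior_lower (R : realType) (c1 c2 : R) (p r : nat) (pi : nat -> R) :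
    Prop :=
  (forall k, (1 <= k < r)%N ->
     (k%:R / (p%:R * expR 1)) `^ (c1 * k%:R) <= pi k)
  /\ expR (- (c2 * r%:R)) <= pi r.

Definition rate (R : realType) (p r p0 : nat) : R :=
  Num.min (p0%:R * (ln (p%:R / p0%:R) + 1)) r%:R.

(* Main.v *)
Require Import Defs.
From HB Require Import structures.
From mathcomp Require Import all_boot all_order all_algebra.
From mathcomp Require Import all_classical all_reals all_analysis.
From mathcomp Require Import measurable_realfun.
From mathcomp Require Import perm zify ring lra.

Set Implicit Arguments.
Unset Strict Implicit.
Unset Printing Implicit Defensive.

Import Order.TTheory GRing.Theory Num.Theory.
Import numFieldNormedType.Exports.
Local Open Scope classical_set_scope.
Local Open Scope ring_scope.

(* Risk bounds for least squares selectors. If y = mu + e and the selected fit f satisfies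
   |y - f|^2 + pen <= |y - mu|^2 + K, then w = f - mu lies in one of finitely many spans and
   |w|^2 <= 2 <e, w> + K - pen; bounding 2 <e, w> by a |w|^2 plus the squared projection of e
   divided by a, the risk is controlled by the exponential moments of chi-square variables,
   summed over the family. For the MAP penalty this sum is at most the total prior mass 1;
   for Part 1 the selector is least squares over the models of size p0, or the saturated fit.

   Lower bound. Let k = min(p0, r/2) and take k disjoint blocks of m = p/k columns; theta
   picks one column in each block, with amplitude A, A^2 = sigma^2 ln m / (2 phi_max). With
   theta uniform, the likelihood ratios against the mean without the block considered show
   that each block is decoded wrongly with probability at least 1/8, and two means whose
   thetas differ in j blocks are at squared distance at least phi_min A^2 j. Hence a risk of
   order (phi_min / phi_max) sigma^2 k ln m, which is of the order of the rate. *)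

(** Two demands compete in the choice of the exponent [t] for the MAP selector. The union bound over
    models needs 2 t s^2 (1 + 1/gamma) > 1, so that the penalty returns the logarithm of the inverse
    prior mass with a surplus. Finite chi-square moments need 2 t s^2 < a, and a < 1 is needed to
    absorb a |w|^2 in the loss. Since gamma / (gamma + 1) < 1 there is room, and the constants 1/2
    and 3/4 added to gamma place [t] and [a] inside it. The true mean need not lie in the span of
    the selected model, so the spans are those of unions with a fixed model carrying the mean; its
    further dimensions add a term of the order of the rate. Saturated models share one span and
    enter the union bound once: counted separately they would cost a factor C(p, r), which neither
    [Pen] at [r] nor a rate [r] can pay. The noise is given by its law on boxes, so independence,
    exponential moments and the change of mean are all derived from products of indicators. *)

(** * Integration against weighted image measures *)

Section weighted_law.
Context d1 d2 (T : measurableType d1) (U : measurableType d2) (R : realType).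
Variables (mu : {measure set T -> \bar R}) (nu : {measure set U -> \bar R}).
Variables (W : T -> R) (phi : T -> U).
Hypotheses (W_ge0 : forall x, 0 <= W x) (mW : measurable_fun setT W).
Hypothesis mphi : measurable_fun setT phi.
Hypothesis nuE : forall B, measurable B ->
  nu B = (\int[mu]_x (W x * \1_B (phi x))%:E)%E.

Import HBNNSimple.

(** Extended from indicators by linearity and monotone convergence. Knowing [nu] on sets is the form
    in which densities, joint laws and changes of mean appear below. *)
Lemma ge0_integral_weighted (f : U -> \bar R) :
  measurable_fun setT f -> (forall y, 0 <= f y)%E ->
  (\int[nu]_y f y = \int[mu]_x ((W x)%:E * f (phi x)))%E.
Proof.
move=> mf f0; pose f_ := nnsfun_approx measurableT mf.
have cf y : (f_ n y)%:E @[n --> \oo] --> f y.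
  exact: (@cvg_nnsfun_approx _ _ _ _ measurableT f mf (fun y _ => f0 y) y I).
have ndf y : {homo (fun n => (f_ n y)%:E) : m n / (m <= n)%N >-> (m <= n)%E}.
  by move=> m n mn; rewrite lee_fin; exact/lefP/nd_nnsfun_approx.
have mWE : measurable_fun setT (fun x => (W x)%:E) by exact/measurable_EFinP.
transitivity (limn (fun n => \int[nu]_y (f_ n y)%:E))%E.
  rewrite -monotone_convergence//.
  - by apply: eq_integral => y _; apply/esym/cvg_lim.
  - by move=> n; exact/measurable_EFinP.
  - by move=> n y _; rewrite lee_fin.
transitivity (limn (fun n => \int[mu]_x ((W x)%:E * (f_ n (phi x))%:E)))%E; last first.
  rewrite -monotone_convergence//.
  - apply: eq_integral => x _; apply/cvg_lim => //.
    by apply: cvgeZl => //; exact: cf.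
  - move=> n; apply: emeasurable_funM => //.
    by apply/measurable_EFinP; apply: measurableT_comp.
  - by move=> n x _; rewrite mule_ge0// lee_fin.
  - by move=> x _ m n mn; rewrite lee_wpmul2l ?lee_fin//; apply/ndf.
congr (limn _); apply/funext => n.
transitivity (\int[nu]_y (\sum_(r \in range (f_ n))
   (r * \1_(f_ n @^-1` [set r]) y)%:E))%E.
  by apply: eq_integral => y _; rewrite /= fimfunE -fsumEFin.
rewrite ge0_integral_fsum//; last 2 first.
  - by move=> r; apply/measurable_EFinP; exact: measurable_funM.
  - by move=> r y _; exact: nnfun_muleindic_ge0.
transitivity (\int[mu]_x (\sum_(r \in range (f_ n))
   ((W x)%:E * (r * \1_(f_ n @^-1` [set r]) (phi x))%:E)))%E; last first.
  apply: eq_integral => x _; rewrite fimfunE -fsumEFin// ge0_mule_fsumr//.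
  by move=> r; exact: nnfun_muleindic_ge0.
have mI r : measurable_fun setT (fun x => (\1_(f_ n @^-1` [set r]) (phi x) : R)).
  by apply: (measurableT_comp _ mphi); exact: measurable_indic.
rewrite ge0_integral_fsum//; last 2 first.
  - move=> r; apply: emeasurable_funM => //; apply/measurable_EFinP.
    by apply: measurable_funM => //.
  - by move=> r x _; rewrite mule_ge0 ?lee_fin//; exact: nnfun_muleindic_ge0.
apply: eq_fsbigr => r /[!inE] -[y _ ry].
have r0 : 0 <= r by rewrite -ry.
rewrite integralZl_indic_nnsfun// integral_indic// setIT nuE//.
rewrite -ge0_integralZl//.
- by apply: eq_integral => x _; rewrite -!EFinM mulrCA.
- by apply/measurable_EFinP; exact: measurable_funM.
- by move=> x _; rewrite lee_fin mulr_ge0.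
Qed.

End weighted_law.

(** Packs the weighted law as a measure, so that uniqueness of measures applies to it in
    [gaussian_shift]. *)
Lemma ge0_weighted_law_measure d1 d2 (T : measurableType d1)
  (U : measurableType d2) (R : realType) (mu : {measure set T -> \bar R})
  (W : T -> R) (phi : T -> U) : (forall x, 0 <= W x) ->
  measurable_fun setT W -> measurable_fun setT phi ->
  exists nu : {measure set U -> \bar R},
    forall B, measurable B -> nu B = (\int[mu]_x (W x * \1_B (phi x))%:E)%E.
Proof.
move=> W0 mW mphi; pose m B := (\int[mu]_x (W x * \1_B (phi x))%:E)%E.
have m0 : m set0 = 0%E.
  by rewrite /m; apply: integral0_eq => x _; rewrite indic0 mulr0.
have mge0 B : (0 <= m B)%E.
  by apply: integral_ge0 => x _; rewrite lee_fin mulr_ge0.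
have mWB B : measurable B -> measurable_fun setT (fun x => (W x * \1_B (phi x))%:E).
  move=> mB; apply/measurable_EFinP; apply: measurable_funM => //.
  by apply: (measurableT_comp _ mphi); exact: measurable_indic.
have madd : semi_sigma_additive m.
  move=> F mF tF mUF; rewrite /m.
  rewrite [X in _ --> X](_ : _ =
      \sum_(0 <= k <oo) (\int[mu]_x (W x * \1_(F k) (phi x))%:E))%E.
    apply: is_cvg_nneseries => n _ _; exact: mge0.
  rewrite -integral_nneseries//; last 2 first.
    by move=> n; apply: mWB.
    by move=> n x _; rewrite lee_fin mulr_ge0.
  apply: eq_integral => x _.
  under eq_eseriesr do rewrite EFinM.
  rewrite nneseriesZl//.
  by rewrite EFinM indic_bigcup//.
pose nu : {measure set U -> \bar R} :=
  HB.pack m (isMeasure.Build _ _ _ m m0 mge0 madd).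
by exists nu.
Qed.

(** * Measurability of matrix-valued maps *)

Section matrix_measurability.
Context (R : realType).

Lemma measurable_mx_entry m n (i : 'I_m) (j : 'I_n) :
  measurable_fun setT (fun A : 'M[R]_(m, n) => A i j).
Proof.
move=> _ B mB; rewrite setTI; apply: sub_sigma_algebra.
by exists (i, j) => //=; exists B => //; rewrite setTI.
Qed.

Lemma measurable_mxP d (T : measurableType d) m n (f : T -> 'M[R]_(m, n)) :
  measurable_fun setT f <-> forall i j, measurable_fun setT (fun w => f w i j).
Proof.
split=> [mf i j|mf]; first exact: (measurableT_comp (measurable_mx_entry i j) mf).
apply: (@measurability _ _ _ _ _ _ (\bigcup_(ij in [set: 'I_m * 'I_n])
   preimage_set_system setT (fun A : 'M[R]_(m, n) => A ij.1 ij.2) measurable)) => //.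
move=> _ [_ [[i j] _ [B mB <-]] <-]; rewrite setTI.
have := mf i j measurableT B mB; rewrite setTI.
by congr (_ _); apply/seteqP; split => w //= [].
Qed.

Lemma measurable_coord d (T : measurableType d) n (f : T -> 'cV[R]_n) i :
  measurable_fun setT f -> measurable_fun setT (fun w => f w i ord0).
Proof. by move=> /measurable_mxP. Qed.

Lemma measurable_mulmxr d (T : measurableType d) m n (A : 'M[R]_(m, n))
  (f : T -> 'cV[R]_n) : measurable_fun setT f ->
  measurable_fun setT (fun w => A *m f w).
Proof.
move=> mf; apply/measurable_mxP => i j.
under eq_fun do rewrite mxE.
apply: measurable_sum => k; apply: measurable_funM => //.
by move/measurable_mxP : mf; apply.
Qed.

Lemma measurable_addmx d (T : measurableType d) m n (f g : T -> 'M[R]_(m, n)) :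
  measurable_fun setT f -> measurable_fun setT g ->
  measurable_fun setT (fun w => f w + g w).
Proof.
move=> /measurable_mxP mf /measurable_mxP mg; apply/measurable_mxP => i j.
under eq_fun do rewrite mxE.
exact: measurable_funD.
Qed.

Lemma measurable_oppmx d (T : measurableType d) m n (f : T -> 'M[R]_(m, n)) :
  measurable_fun setT f -> measurable_fun setT (fun w => - f w).
Proof.
move=> /measurable_mxP mf; apply/measurable_mxP => i j.
under eq_fun do rewrite mxE.
exact: measurableT_comp.
Qed.

Lemma measurable_normsq d (T : measurableType d) n (f : T -> 'cV[R]_n) :
  measurable_fun setT f -> measurable_fun setT (fun w => normsq (f w)).
Proof.
move=> mf; apply: measurable_sum => i; apply: measurable_funX.
exact: measurable_coord.
Qed.

End matrix_measurability.

(** * The Euclidean inner product *)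

Definition dotmx (R : realType) n (u v : 'cV[R]_n) : R :=
  \sum_i u i ord0 * v i ord0.

Section dot_product.
Context (R : realType) (n : nat).
Implicit Types u v w : 'cV[R]_n.

Lemma dotC u v : dotmx u v = dotmx v u.
Proof. by apply: eq_bigr => i _; rewrite mulrC. Qed.

Lemma dotDr u v w : dotmx u (v + w) = dotmx u v + dotmx u w.
Proof.
by rewrite -big_split; apply: eq_bigr => i _; rewrite mxE mulrDr.
Qed.

Lemma dotDl u v w : dotmx (v + w) u = dotmx v u + dotmx w u.
Proof. by rewrite dotC dotDr !(dotC u). Qed.

Lemma dotZr a u v : dotmx u (a *: v) = a * dotmx u v.
Proof.
by rewrite mulr_sumr; apply: eq_bigr => i _; rewrite mxE mulrCA.
Qed.

Lemma dotZl a u v : dotmx (a *: v) u = a * dotmx v u.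
Proof. by rewrite dotC dotZr dotC. Qed.

Lemma dotNr u v : dotmx u (- v) = - dotmx u v.
Proof. by rewrite -scaleN1r dotZr mulN1r. Qed.

Lemma dotNl u v : dotmx (- v) u = - dotmx v u.
Proof. by rewrite -scaleN1r dotZl mulN1r. Qed.

Lemma dot0r u : dotmx u 0 = 0.
Proof. by rewrite -(scale0r 0) dotZr mul0r. Qed.

Lemma dot0l u : dotmx 0 u = 0.
Proof. by rewrite dotC dot0r. Qed.

Lemma dot_sumr (I : Type) (r : seq I) (P : pred I) (F : I -> 'cV[R]_n) u :
  dotmx u (\sum_(i <- r | P i) F i) = \sum_(i <- r | P i) dotmx u (F i).
Proof. exact: (big_morph _ (dotDr u) (dot0r u)). Qed.

Lemma dot_suml (I : Type) (r : seq I) (P : pred I) (F : I -> 'cV[R]_n) u :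
  dotmx (\sum_(i <- r | P i) F i) u = \sum_(i <- r | P i) dotmx (F i) u.
Proof. by rewrite dotC dot_sumr; apply: eq_bigr => i _; rewrite dotC. Qed.

Lemma normsqE u : normsq u = dotmx u u.
Proof. by apply: eq_bigr => i _; rewrite expr2. Qed.

Lemma normsq_ge0 u : 0 <= normsq u.
Proof. by apply: sumr_ge0 => i _; rewrite sqr_ge0. Qed.

Lemma normsq_eq0 u : (normsq u == 0) = (u == 0).
Proof.
apply/eqP/eqP => [/eqP|->]; last by rewrite normsqE dot0r.
rewrite psumr_eq0 => [/allP u0|i _]; last exact: sqr_ge0.
apply/matrixP => i j; rewrite (ord1 j) mxE; apply/eqP.
by have := u0 i (mem_index_enum i); rewrite /= sqrf_eq0.
Qed.

Lemma normsqD u v : normsq (u + v) = normsq u + 2 * dotmx u v + normsq v.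
Proof. by rewrite !normsqE dotDr !dotDl (dotC v u); ring. Qed.

Lemma normsqB u v : normsq (u - v) = normsq u - 2 * dotmx u v + normsq v.
Proof. by rewrite !normsqE dotDr !dotDl !dotNr !dotNl (dotC v u); ring. Qed.

Lemma normsqZ a u : normsq (a *: u) = a ^+ 2 * normsq u.
Proof. by rewrite !normsqE dotZr dotZl mulrA expr2. Qed.

Lemma normsqB_le2 u v w : normsq (u - v) <= 2 * (normsq (w - u) + normsq (w - v)).
Proof.
have -> : u - v = (w - v) - (w - u) by rewrite opprB [RHS]addrC addrA subrK.
move: (w - u) (w - v) => x y.
have := normsq_ge0 (y + x); rewrite normsqD normsqB; lra.
Qed.

Lemma measurable_dotmx d (T : measurableType d) (f g : T -> 'cV[R]_n) :
  measurable_fun setT f -> measurable_fun setT g ->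
  measurable_fun setT (fun x => dotmx (f x) (g x)).
Proof.
move=> mf mg; apply: measurable_sum => i.
by apply: measurable_funM; exact: measurable_coord.
Qed.

End dot_product.

(** * One-dimensional normal laws *)

Section normal_law.
Context (R : realType).
Implicit Types m s v a : R.
Local Notation mu := (@lebesgue_measure R).

Lemma integral_normal_prob_pdf m s (f : R -> \bar R) :
  measurable_fun setT f -> (forall x, 0 <= f x)%E ->
  (\int[normal_prob m s]_x f x = \int[mu]_x ((normal_pdf m s x)%:E * f x))%E.
Proof.
move=> mf f0.
apply: (@ge0_integral_weighted _ _ _ _ _ mu (normal_prob m s) (normal_pdf m s) id) => //.
- exact: normal_pdf_ge0.
- exact: measurable_normal_pdf.
move=> B mB; transitivity (\int[mu]_(x in B) (normal_pdf m s x)%:E)%E => //.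
rewrite [LHS]integral_mkcond; apply: eq_integral => x _.
rewrite patchE indicE; case: (x \in B); by rewrite ?mulr1 ?mulr0.
Qed.

(** Completing the square: the exponential factor is the likelihood ratio of mean [v] against mean
    0. *)
Lemma normal_pdf_tilt s v x : s != 0 ->
  normal_pdf 0 s x * expR (v * x / s ^+ 2 - v ^+ 2 / (2 * s ^+ 2)) =
  normal_pdf v s x.
Proof.
move=> s0; rewrite !normal_pdfE//= -[LHS]mulrA; congr (_ * _).
rewrite /normal_fun -expRD; congr expR.
by field.
Qed.

Lemma lebesgue_measure_shift v (A : set R) : measurable A ->
  pushforward mu (+%R^~ v : _ -> measurableTypeR R) A = mu A.
Proof.
move=> mA; apply/esym/lebesgue_measure_unique => //=.
  by apply: measurable_funD => //; exact: measurable_cst.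
move=> mf _ [[a b]] _ <-; rewrite /pushforward.
have -> : (+%R^~ v) @^-1` `]a, b] = `]a - v, b - v]%classic.
  by apply/seteqP; split => x /=; rewrite !in_itv/= ltrBlDr lerBrDr.
rewrite /= !lebesgue_measure_itv/= !lte_fin ltrD2r.
by case: ifP => // _; rewrite -!EFinB opprB addrA subrK.
Qed.

Lemma normal_prob_shift s v (A : set R) : s != 0 -> measurable A ->
  normal_prob 0 s ((fun x => x + v) @^-1` A) = normal_prob v s A.
Proof.
move=> s0 mA.
rewrite /normal_prob; transitivity
  (\int[pushforward mu (+%R^~ v : _ -> measurableTypeR R)]_(x in A) (normal_pdf v s x)%:E)%E;
    last first.
  apply: eq_measure_integral => //=.
    by apply: measurable_funD => //; exact: measurable_cst.
  by move=> mf B mB _; exact: lebesgue_measure_shift.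
rewrite ge0_integral_pushforward//.
- by apply: eq_integral => x _ /=; rewrite !normal_pdfE//= /normal_fun subr0 addrK.
- by apply: measurable_funD => //; exact: measurable_cst.
- by apply/measurable_EFinP; apply: measurable_funTS; exact: measurable_normal_pdf.
- by move=> y _; rewrite lee_fin normal_pdf_ge0.
Qed.

Lemma normal_prob_expR s a : s != 0 ->
  (\int[normal_prob 0 s]_x (expR (a * x))%:E = (expR (a ^+ 2 * s ^+ 2 / 2))%:E)%E.
Proof.
move=> s0; rewrite integral_normal_prob_pdf//; last first.
  by apply/measurable_EFinP; apply: measurableT_comp => //; apply: measurable_funM.
transitivity (\int[mu]_x ((expR (a ^+ 2 * s ^+ 2 / 2))%:E *
   (normal_pdf (a * s ^+ 2) s x)%:E))%E.
  apply: eq_integral => x _; rewrite -(@normal_pdf_tilt s (a * s ^+ 2))// -!EFinM mulrCA; congr (_%:E).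
  by rewrite -expRD; congr (_ * expR _); field.
rewrite ge0_integralZl//.
- by rewrite integral_normal_pdf mule1.
- by apply/measurable_EFinP; exact: measurable_normal_pdf.
- by move=> x _; rewrite lee_fin normal_pdf_ge0.
Qed.

Lemma normal_prob_expR_sqr t : 2 * t < 1 ->
  (\int[normal_prob 0 1]_x (expR (t * x ^+ 2))%:E =
   (expR (- ln (1 - 2 * t) / 2))%:E :> \bar R)%E.
Proof.
move=> t1; have q0 : 0 < 1 - 2 * t by lra.
pose q := expR (- ln (1 - 2 * t) / 2).
have q2 : q ^+ 2 = (1 - 2 * t)^-1.
  by rewrite /q -expRM_natl mulrCA divff// mulr1 expRN lnK.
have qgt0 : 0 < q by exact: expR_gt0.
rewrite integral_normal_prob_pdf//; last first.
  apply/measurable_EFinP; apply: measurableT_comp => //; exact: measurable_funM.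
(* The standard density times exp(t x^2) is again a centred Gaussian shape, of variance 1/(1 - 2t) =
   q^2; renormalising it produces the factor [q]. *)
transitivity (\int[mu]_x (q%:E * (normal_pdf 0 q x)%:E))%E.
  apply: eq_integral => x _; rewrite -!EFinM; congr (_%:E).
  rewrite !normal_pdfE ?gt_eqF//= -[LHS]mulrA [RHS]mulrA /normal_fun -expRD.
  congr (_ * expR _); last first.
    by rewrite q2 !subr0; field; rewrite gt_eqF//=.
  rewrite /normal_peak expr1n mul1r -mulrnAr sqrtrM ?sqr_ge0//.
  by rewrite sqrtr_sqr gtr0_norm// invfM mulrA divff ?gt_eqF// mul1r.
rewrite ge0_integralZl//.
- by rewrite integral_normal_pdf mule1.
- by apply/measurable_EFinP; exact: measurable_normal_pdf.
- by move=> x _; rewrite lee_fin normal_pdf_ge0.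
- by rewrite lee_fin ltW.
Qed.

End normal_law.

Lemma box_bigsetI (T S : Type) (I : finType) (f : I -> T -> S) (A : I -> set S) :
  [set w | forall i, A i (f i w)] = \big[setI/setT]_i (f i @^-1` A i).
Proof.
rewrite -bigcap_seq; apply/seteqP; split => w /= Aw i; first by move=> _; exact: Aw.
by apply: Aw; rewrite /= mem_index_enum.
Qed.

(** * Gaussian vectors: independence, exponential moments, change of mean *)

Section gaussian_noise_theory.
Context (R : realType) d (Omega : measurableType d) (P : probability Omega R).
Context (n : nat) (s : R) (eps : Omega -> 'cV[R]_n).
Hypotheses (s_gt0 : 0 < s) (eps_normal : gaussian_noise P s eps).
Local Notation N := (normal_prob 0 s).

Let meps : measurable_fun setT eps := eps_normal.1.

Let meps_coord i : measurable_fun setT (fun w => eps w i ord0).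
Proof. exact: measurable_coord. Qed.

Lemma gaussian_expectation_prod (g : 'I_n -> R -> R) :
  (forall i x, 0 <= g i x) -> (forall i, measurable_fun setT (g i)) ->
  (forall i, \int[N]_x (g i x)%:E < +oo)%E ->
  (\int[P]_w (\prod_i g i (eps w i ord0))%:E =
   \prod_i \int[N]_x (g i x)%:E)%E.
Proof.
move: g; suff H : forall (r : seq 'I_n) (g : 'I_n -> R -> R),
    (forall i, i \notin r -> exists2 A, measurable A & g i = \1_A) ->
    (forall i x, 0 <= g i x) -> (forall i, measurable_fun setT (g i)) ->
    (forall i, \int[N]_x (g i x)%:E < +oo)%E ->
    (\int[P]_w (\prod_i g i (eps w i ord0))%:E =
     \prod_i \int[N]_x (g i x)%:E)%E.
  by move=> g; apply: (H (enum 'I_n)) => i; rewrite mem_enum.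
elim=> [|j r IH] g gE g0 mg gfin.
  have /choice[A AP] : forall i, exists A, measurable A /\ g i = \1_A.
    by move=> i; have [//|A mA ->] := gE i; exists A.
  transitivity (P [set w | forall i, A i (eps w i ord0)]); last first.
    rewrite eps_normal.2 => [|i]; last exact: (AP i).1.
    by apply: eq_bigr => i _; rewrite (AP i).2 integral_indic ?setIT//; exact: (AP i).1.
  rewrite (box_bigsetI (fun i w => eps w i ord0)).
  rewrite -(setIT (\big[setI/setT]_i _)) -integral_indic//; last first.
    apply: bigsetI_measurable => i _; rewrite -[X in measurable X]setTI.
    by apply: meps_coord => //; exact: (AP i).1.
  apply: eq_integral => w _; congr EFin.
  under eq_bigr do rewrite (AP _).2.
  elim/big_rec2: _ => [|i x B _ ->]; first by rewrite indicT.
  by rewrite indicI.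
(* With an indicator in place of the factor at [j] the induction hypothesis applies. It shows that
   the law of coordinate [j], weighted by the other factors, is [K] times the normal law, and this
   determines the integral of [g j]. *)
pose h B i := if i == j then \1_B else g i : R -> R.
have hprod B w : \prod_i h B i (eps w i ord0) =
    (\prod_(i | i != j) g i (eps w i ord0)) * \1_B (eps w j ord0).
  rewrite (bigD1 j)//= {1}/h eqxx mulrC; congr (_ * _).
  by apply: eq_bigr => i /negPf ij; rewrite /h ij.
have gprod w : \prod_i g i (eps w i ord0) =
    (\prod_(i | i != j) g i (eps w i ord0)) * g j (eps w j ord0).
  by rewrite (bigD1 j)//= mulrC.
have mW : measurable_fun setT (fun w => \prod_(i | i != j) g i (eps w i ord0)).
  rewrite (_ : (fun w => _) = fun w => \prod_(i <- [seq i <- index_enum 'I_n | i != j]) g i (eps w i ord0)).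
    by apply: measurable_prod => i _; apply: (measurableT_comp (mg i)).
  by apply/funext => w; rewrite big_filter.
have W0 w : 0 <= \prod_(i | i != j) g i (eps w i ord0) by exact: prodr_ge0.
have K0 : (0 <= \prod_(i | i != j) \int[N]_x (g i x)%:E)%E.
  by apply: prode_ge0 => i _; apply: integral_ge0 => x _; rewrite lee_fin.
have Kfin : (\prod_(i | i != j) \int[N]_x (g i x)%:E)%E \is a fin_num.
  apply: prode_fin_num => i _; rewrite ge0_fin_numE//.
  by apply: integral_ge0 => x _; rewrite lee_fin.
pose K := fine (\prod_(i | i != j) \int[N]_x (g i x)%:E)%E.
have KE : (\prod_(i | i != j) \int[N]_x (g i x)%:E)%E = K%:E by rewrite fineK.
have Kge0 : 0 <= K by rewrite -lee_fin -KE.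
have hE B : measurable B ->
    (\int[P]_w (\prod_i h B i (eps w i ord0))%:E = K%:E * N B)%E.
  move=> mB; rewrite IH.
  - rewrite (bigD1 j)//= {1}/h eqxx integral_indic// setIT muleC; congr (_ * _)%E.
    by rewrite -KE; apply: eq_bigr => i /negPf ij; rewrite /h ij.
  - move=> i ir; rewrite /h; case: eqP => [_|/eqP ij]; first by exists B.
    by apply: gE; rewrite inE negb_or ij.
  - by move=> i x; rewrite /h; case: eqP.
  - by move=> i; rewrite /h; case: eqP => // _; exact: measurable_indic.
  - move=> i; rewrite /h; case: eqP => // _; rewrite integral_indic// setIT.
    by rewrite (le_lt_trans (probability_le1 _ _)) ?ltry.
pose nu : {measure set (measurableTypeR R) -> \bar R} := mscale (NngNum Kge0) N.
have nuE B : measurable B -> nu B = (\int[P]_w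
    ((\prod_(i | i != j) g i (eps w i ord0)) * \1_B (eps w j ord0))%:E)%E.
  move=> mB; transitivity (K%:E * N B)%E => //; rewrite -hE//.
  by apply: eq_integral => w _; rewrite hprod.
have mgE i : measurable_fun setT (EFin \o g i) by exact/measurable_EFinP.
transitivity (\int[nu]_x (EFin \o g j) x)%E.
  rewrite (@ge0_integral_weighted _ _ _ (measurableTypeR R) _ P nu _ _ W0 mW (meps_coord j) nuE).
  - by apply: eq_integral => w _; rewrite gprod EFinM.
  - exact: mgE.
  - by move=> y; rewrite lee_fin.
transitivity (K%:E * \int[N]_x (EFin \o g j) x)%E; last first.
  by rewrite [RHS](bigD1 j)//= muleC KE.
apply: ge0_integral_mscale => //; first exact: mgE.
by move=> y _; rewrite lee_fin.
Qed.

Lemma gaussian_mgf (u : 'cV[R]_n) :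
  (\int[P]_w (expR (dotmx u (eps w)))%:E =
   (expR (normsq u * s ^+ 2 / 2))%:E)%E.
Proof.
transitivity (\int[P]_w (\prod_i expR (u i ord0 * eps w i ord0))%:E)%E.
  by apply: eq_integral => w _; rewrite -expR_sum.
have mgf i : (\int[N]_x (expR (u i ord0 * x))%:E =
    (expR (u i ord0 ^+ 2 * s ^+ 2 / 2))%:E)%E.
  by rewrite normal_prob_expR// gt_eqF.
rewrite (gaussian_expectation_prod (g := fun i x => expR (u i ord0 * x))).
- under eq_bigr do rewrite mgf.
  rewrite prodEFin -expR_sum; congr (expR _)%:E.
  by rewrite -!mulr_suml.
- by move=> i x; exact: expR_ge0.
- by move=> i; apply: measurableT_comp => //; exact: measurable_funM.
- by move=> i; rewrite mgf ltry.
Qed.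

(** The likelihood ratio at [y] of the normal law of mean [v] against the centred one, both with
    covariance s^2 I. *)
Definition tilt (v y : 'cV[R]_n) : R :=
  expR (dotmx v y / s ^+ 2 - normsq v / (2 * s ^+ 2)).

Lemma tilt_gt0 v y : 0 < tilt v y. Proof. exact: expR_gt0. Qed.

Lemma measurable_tilt v : measurable_fun setT (tilt v).
Proof.
apply: measurableT_comp => //; apply: measurable_funB => //.
by apply: measurable_funM => //; apply: measurable_dotmx.
Qed.

(** The Cameron-Martin formula. The law of [v + eps] and the law of [eps] weighted by [tilt] agree
    on boxes, where both factor over the coordinates, and boxes form a pi-system generating the
    sigma-algebra. *)
Lemma gaussian_shift (v : 'cV[R]_n) (g : 'cV[R]_n -> R) :
  measurable_fun setT g -> (forall y, 0 <= g y) ->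
  (\int[P]_w (g (v + eps w)%R)%:E = \int[P]_w (tilt v (eps w) * g (eps w))%:E)%E.
Proof.
move=> mg g0.
have mL : measurable_fun setT (fun w => tilt v (eps w)).
  exact: (measurableT_comp (measurable_tilt v)).
have mveps : measurable_fun setT (fun w => v + eps w).
  by apply: measurable_addmx.
have L0 w : 0 <= tilt v (eps w) by rewrite ltW ?tilt_gt0.
have [nu nuE] := ge0_weighted_law_measure P L0 mL meps.
have gE0 y : (0 <= (g y)%:E)%E by rewrite lee_fin.
have mgE : measurable_fun setT (EFin \o g) by exact/measurable_EFinP.
have := ge0_integral_weighted L0 mL meps nuE mgE gE0.
under [in X in _ = X]eq_integral do rewrite /= -EFinM.
move=> <-.
have := @ge0_integral_pushforward _ _ _ _ _ (fun w => v + eps w) mveps P setT _ measurableT mgE (fun y _ => gE0 y).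
rewrite preimage_setT => /= <-.
apply: eq_measure_integral => B mB _.
have mcoord (A : 'I_n -> set R) i : (forall i, measurable (A i)) ->
    measurable ((fun y : 'cV[R]_n => y i ord0) @^-1` A i).
  by move=> mA; rewrite -[X in measurable X]setTI; exact: (measurable_mx_entry i ord0).
have boxE (A : 'I_n -> set R) : [set y : 'cV[R]_n | forall i, A i (y i ord0)] =
    \big[setI/setT]_i ((fun y : 'cV[R]_n => y i ord0) @^-1` A i).
  exact: (box_bigsetI (fun i (y : 'cV[R]_n) => y i ord0)).
pose G := [set B : set 'cV[R]_n | exists2 A : 'I_n -> set R,
  (forall i, measurable (A i)) & B = [set y | forall i, A i (y i ord0)]].
apply: (measure_unique G (fun=> setT)) => //.
- apply/seteqP; split.
    apply: smallest_sub; first exact: smallest_sigma_algebra.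
    move=> _ [[i j] _ [A mA <-]]; rewrite setTI; apply: sub_sigma_algebra.
    exists (fun k => if k == i then A else setT).
      by move=> k; case: ifP.
    apply/seteqP; split => y /=; rewrite (ord1 j).
      by move=> Ay k; case: eqP => // ->.
    by move/(_ i); rewrite eqxx.
  apply: smallest_sub; first exact: sigma_algebra_measurable.
  move=> _ [A mA ->]; rewrite [X in measurable X](boxE A).
  by apply: bigsetI_measurable => i _; exact: mcoord.
- move=> _ _ [A mA ->] [B' mB' ->].
  exists (fun i => A i `&` B' i); first by move=> i; exact: measurableI.
  by apply/seteqP; split => y /=; [case=> ? ? i; split|move=> H; split => i; have [] := H i].
- by move=> _; exists (fun=> setT) => //; apply/seteqP; split.
- by rewrite bigcup_const.
- move=> C [A mA CE]; have CE' := etrans CE (boxE A).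
  have mshift i : measurable ((fun x => x + v i ord0) @^-1` A i).
    rewrite -[X in measurable X]setTI.
    by apply: (measurable_funD (f := id) (g := cst (v i ord0))) => //.
  rewrite nuE; last first.
    rewrite CE'; apply: bigsetI_measurable => i _; exact: mcoord.
  transitivity (P [set w | forall i, ((fun x => x + v i ord0) @^-1` A i) (eps w i ord0)]).
    transitivity (P ((fun w => v + eps w) @^-1` C)) => //.
    by congr (P _); rewrite CE; apply/seteqP; split => w /= H i; have := H i; rewrite mxE addrC.
  rewrite (eps_normal.2 _ mshift).
  pose l i x := expR (v i ord0 * x / s ^+ 2 - v i ord0 ^+ 2 / (2 * s ^+ 2)).
  have l0 i x : 0 <= l i x * \1_(A i) x by rewrite mulr_ge0 ?expR_ge0.
  have ml i : measurable_fun setT (fun x => l i x * \1_(A i) x).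
    apply: measurable_funM; last exact: measurable_indic.
    apply: measurableT_comp => //; apply: measurable_funB => //.
    by apply: measurable_funM => //; exact: measurable_funM.
  have lE i : (\int[N]_x (l i x * \1_(A i) x)%:E = N ((fun x => x + v i ord0)%R @^-1` A i))%E.
    rewrite normal_prob_shift ?gt_eqF// integral_normal_prob_pdf; last 2 first.
    + exact/measurable_EFinP.
    + by move=> x; rewrite lee_fin.
    transitivity (\int[lebesgue_measure]_(x in A i) (normal_pdf (v i ord0) s x)%:E)%E => //.
    rewrite [RHS]integral_mkcond; apply: eq_integral => x _.
    rewrite patchE indicE -(@normal_pdf_tilt _ s (v i ord0)) ?gt_eqF// -EFinM mulrA.
    by case: (x \in A i); rewrite ?mulr1 ?mulr0.
  rewrite (eq_bigr (fun i => \int[N]_x (l i x * \1_(A i) x)%:E)%E)//.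
  rewrite -(gaussian_expectation_prod (g := fun i x => l i x * \1_(A i) x))//.
  + apply: eq_integral => w _; congr EFin; rewrite big_split/= -expR_sum.
    congr (expR _ * _).
      by rewrite sumrB -!mulr_suml.
    rewrite CE' (big_morph (fun B : set 'cV[R]_n => \1_B (eps w) : R)
      (op1 := *%R) (id1 := 1)) => [//|B1 B2|]; first by rewrite indicI.
    by rewrite indicT.
  + move=> i; rewrite lE.
    by apply: le_lt_trans (probability_le1 (normal_prob 0 s) (mshift i)) _; exact: ltry.
- move=> _; apply: (@le_lt_trans _ _ (P setT)) => //.
  by rewrite probability_setT ltry.
Qed.

End gaussian_noise_theory.

(** * Exponential moments of squared projections *)

Definition orthonormal (R : realType) n (U : seq 'cV[R]_n) : bool :=
  pairwise (fun u v => dotmx u v == 0) U && all (fun u => dotmx u u == 1) U.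

(* Each square is linearised by expR (t x^2) = E expR (sqrt (2 t) x z) with z a standard
   normal variable independent of eps; after Tonelli the sum over U loses a term and the
   linear form w is shifted by a multiple of the vector removed, orthogonal to the rest. *)
Lemma gaussian_sqr_mgf (R : realType) d (Omega : measurableType d)
  (P : probability Omega R) n (s : R) (eps : Omega -> 'cV[R]_n) (t : R)
  (U : seq 'cV[R]_n) (w : 'cV[R]_n) :
  0 < s -> gaussian_noise P s eps -> 0 <= t -> 2 * t * s ^+ 2 < 1 ->
  orthonormal U -> all (fun u => dotmx w u == 0) U ->
  (\int[P]_x (expR (t * (\sum_(u <- U) dotmx u (eps x) ^+ 2) + dotmx w (eps x)))%:E =
   (expR ((size U)%:R * (- ln (1 - 2 * t * s ^+ 2) / 2) + normsq w * s ^+ 2 / 2))%:E)%E.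
Proof.
move=> s0 Ne t0 ts; have meps := Ne.1.
elim: U w => [|u U IH] w.
  move=> _ _; rewrite mul0r add0r -(gaussian_mgf s0 Ne).
  by apply: eq_integral => x _; rewrite big_nil mulr0 add0r.
rewrite /orthonormal /= => /andP[/andP[uU pU] /andP[/eqP uu aU]] /andP[/eqP wu wU].
pose q := Num.sqrt (2 * t).
have q2 : q ^+ 2 = 2 * t by rewrite sqr_sqrtr// mulr_ge0.
pose F (xz : Omega * measurableTypeR R) : \bar R := (expR (
   (t * (\sum_(u <- U) dotmx u (eps xz.1) ^+ 2) + dotmx w (eps xz.1)) +
   q * dotmx u (eps xz.1) * xz.2))%:E.
have mdot v : measurable_fun setT (fun xz : Omega * measurableTypeR R => dotmx v (eps xz.1)).
  by apply: measurable_dotmx => //; exact: measurableT_comp.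
have mF : measurable_fun setT F.
  apply/measurable_EFinP; apply: measurableT_comp => //.
  apply: measurable_funD.
    apply: measurable_funD => //; apply: measurable_funM => //.
    by apply: measurable_sum => v; apply: measurable_funX.
  by apply: measurable_funM => //; apply: measurable_funM.
have F0 xz : (0 <= F xz)%E by rewrite lee_fin expR_ge0.
transitivity (\int[P]_x \int[normal_prob 0 1]_z F (x, z))%E.
  apply: eq_integral => x _; rewrite big_cons /F /=.
  under eq_integral do rewrite expRD EFinM.
  rewrite ge0_integralZl//; last first.
    by apply/measurable_EFinP; apply: measurableT_comp => //; exact: measurable_funM.
  rewrite normal_prob_expR ?oner_eq0// -EFinM -expRD; congr (expR _)%:E.
  by rewrite exprMn q2; field.
rewrite (@fubini_tonelli _ _ _ _ _ P (normal_prob 0 1) F mF F0).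
transitivity (\int[normal_prob 0 1]_z ((expR ((size U)%:R * (- ln (1 - 2 * t * s ^+ 2) / 2) +
   normsq w * s ^+ 2 / 2))%:E * (expR (t * s ^+ 2 * z ^+ 2))%:E))%E.
  apply: eq_integral => z _; rewrite /F /=.
  transitivity (\int[P]_x (expR (t * (\sum_(u <- U) dotmx u (eps x) ^+ 2) +
      dotmx (w + (q * z) *: u) (eps x)))%:E)%E.
    by apply: eq_integral => x _; rewrite dotDl dotZl addrA mulrAC.
  rewrite IH; last 2 first.
  - by rewrite /orthonormal pU.
  - apply/allP => v vU; rewrite dotDl dotZl.
    by rewrite (eqP (allP wU _ vU)) (eqP (allP uU _ vU)) mulr0 addr0.
  rewrite -EFinM -expRD; congr (expR _)%:E.
  (* As [w] is orthogonal to [u], the squared norm of the shifted form splits, and what depends on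
     [z] is a one-dimensional chi-square moment. *)
  by rewrite normsqD dotZr wu normsqZ (normsqE u) uu exprMn q2; field.
rewrite ge0_integralZl//; last first.
  by apply/measurable_EFinP; apply: measurableT_comp => //; apply: measurable_funM.
rewrite normal_prob_expR_sqr; last by rewrite mulrA.
rewrite -EFinM -expRD; congr (expR _)%:E.
by rewrite -natr1 !mulrA; ring.
Qed.

(** * Spans of orthonormal families and Gram-Schmidt *)

Section orthonormal_families.
Context (R : realType) (n : nat).
Implicit Types (U : seq 'cV[R]_n) (w : 'cV[R]_n).

(** Membership is stated as invariance under the projection, with canonical coefficients instead of
    existential ones; Parseval and closure under linear operations are then direct computations. *)
Definition in_span U w : Prop := w = \sum_(u <- U) dotmx u w *: u.

Lemma in_span0 U : in_span U 0.
Proof. by rewrite /in_span big1// => u _; rewrite dot0r scale0r. Qed.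

Lemma in_spanD U v w : in_span U v -> in_span U w -> in_span U (v + w).
Proof.
move=> hv hw; rewrite /in_span {1}hv {1}hw -big_split; apply: eq_bigr => u _.
by rewrite dotDr scalerDl.
Qed.

Lemma in_spanZ U a w : in_span U w -> in_span U (a *: w).
Proof.
move=> hw; rewrite /in_span {1}hw scaler_sumr; apply: eq_bigr => u _.
by rewrite dotZr scalerA.
Qed.

Lemma in_spanB U v w : in_span U v -> in_span U w -> in_span U (v - w).
Proof. by move=> hv hw; rewrite -scaleN1r; apply: in_spanD => //; exact: in_spanZ. Qed.

Lemma in_span_sum U (I : Type) (r : seq I) (Q : pred I) (F : I -> 'cV[R]_n) :
  (forall i, Q i -> in_span U (F i)) -> in_span U (\sum_(i <- r | Q i) F i).
Proof. by move=> H; apply: big_ind => //; [exact: in_span0|exact: in_spanD]. Qed.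

Lemma dot_in_span U w e : in_span U w ->
  dotmx e w = \sum_(u <- U) dotmx u w * dotmx u e.
Proof.
move=> hw; rewrite {1}hw dot_sumr; apply: eq_bigr => u _.
by rewrite dotZr (dotC e).
Qed.

Lemma dot_orthonormal U v w : all (fun u => dotmx v u == 0) U -> in_span U w ->
  dotmx v w = 0.
Proof.
move=> vU hw; rewrite hw dot_sumr big_seq big1// => u uU.
by rewrite dotZr (eqP (allP vU _ uU)) mulr0.
Qed.

Lemma normsq_in_span U w : in_span U w -> normsq w = \sum_(u <- U) dotmx u w ^+ 2.
Proof.
by move=> hw; rewrite normsqE (dot_in_span w hw); apply: eq_bigr => u _; rewrite expr2.
Qed.

Lemma orthonormal_coord U (c : 'cV[R]_n -> R) u : orthonormal U -> u \in U ->
  \sum_(v <- U) c v * dotmx v u = c u.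
Proof.
elim: U => //= a U IH; rewrite /orthonormal /=.
move=> /andP[/andP[aU pU] /andP[/eqP aa nU]]; rewrite inE big_cons.
case: eqP => [-> _|_ /= uU]; last first.
  by rewrite (eqP (allP aU _ uU)) mulr0 add0r IH// /orthonormal pU.
rewrite aa mulr1 big_seq big1 ?addr0// => v vU.
by rewrite dotC (eqP (allP aU _ vU)) mulr0.
Qed.

(** Vectors already in the span are skipped, whence an inequality between sizes; the chi-square
    bounds use only this upper bound on the dimension. *)
Lemma gram_schmidt (xs : seq 'cV[R]_n) : exists U,
  [/\ orthonormal U, (size U <= size xs)%N & {in xs, forall x, in_span U x}].
Proof.
elim: xs => [|x xs [U [oU sU spU]]]; first by exists [::].
have [pU nU] := andP oU.
pose y := x - \sum_(u <- U) dotmx u x *: u.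
have yU : all (fun u => dotmx y u == 0) U.
  apply/allP => u uU; rewrite /y dotDl dotNl dot_suml.
  under eq_bigr do rewrite dotZl.
  by rewrite (orthonormal_coord _ oU uU) dotC subrr.
have xE : x = y + \sum_(u <- U) dotmx u x *: u by rewrite subrK.
have [y0|y0] := eqVneq y 0.
  exists U; split => //; first exact: leqW.
  move=> z; rewrite inE => /orP[/eqP ->|/spU//].
  by rewrite /in_span {1}xE y0 add0r.
have ny : 0 < normsq y by rewrite lt_def normsq_eq0 y0 normsq_ge0.
pose e := (Num.sqrt (normsq y))^-1 *: y.
have eU : all (fun u => dotmx e u == 0) U.
  by apply/allP => u uU; rewrite /e dotZl (eqP (allP yU _ uU)) mulr0.
exists (e :: U); split => //.
  rewrite /orthonormal /= eU pU nU /= andbT -normsqE normsqZ exprVn sqr_sqrtr ?ltW//.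
  by rewrite mulVf ?eqxx ?gt_eqF.
move=> z; rewrite inE /in_span big_cons => /orP[/eqP ->|/spU hz]; last first.
  by rewrite (dot_orthonormal eU hz) scale0r add0r.
rewrite [LHS]xE; congr (_ + _).
have exy : dotmx e x = dotmx e y.
  rewrite {1}xE dotDr dot_sumr big_seq big1 ?addr0// => u uU.
  by rewrite dotZr (eqP (allP eU _ uU)) mulr0.
rewrite exy /e dotZl scalerA -normsqE mulrAC -invfM -expr2 sqr_sqrtr ?ltW//.
by rewrite mulVf ?gt_eqF// scale1r.
Qed.

End orthonormal_families.

(** * Least squares on a model *)

Section least_squares.
Context (R : realType) (n p : nat) (X : 'M[R]_(n, p)).
Implicit Types (M : {set 'I_p}) (y : 'cV[R]_n) (b : 'cV[R]_p).

Definition fit M b : 'cV[R]_n := X *m (model_mx R M *m b).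

Lemma model_mxE M b i : (model_mx R M *m b) i ord0 = (i \in M)%:R * b i ord0.
Proof. by rewrite /model_mx mul_diag_mx !mxE. Qed.

Lemma fitE M b : fit M b = \sum_(i in M) b i ord0 *: col i X.
Proof.
apply/matrixP => k l; rewrite (ord1 l) !mxE summxE [RHS]big_mkcond/=.
apply: eq_bigr => i _; rewrite model_mxE; case: ifP => iM.
  by rewrite mul1r !mxE mulrC.
by rewrite mul0r mulr0.
Qed.

Lemma model_mxK M : model_mx R M *m model_mx R M = model_mx R M.
Proof.
rewrite /model_mx mulmx_diag; congr diag_mx; apply/rowP => i; rewrite !mxE.
by case: (_ \in _); rewrite ?mul1r ?mul0r.
Qed.

Lemma tr_model_mx M : (model_mx R M)^T = model_mx R M.
Proof. exact: tr_diag_mx. Qed.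

Lemma pinv_normal_eq m (A : 'M[R]_(m, p)) :
  A^T *m A *m Defs.pinv (A^T *m A) *m A^T = A^T.
Proof.
set S := A^T *m A; have [SBS BSB SB BS] := Defs.pinvP S; set B := Defs.pinv S in SBS BSB SB BS *.
have ST : S^T = S by rewrite /S trmx_mul trmxK.
have SE : S = A^T *m A by [].
clearbody B; clearbody S.
(* Transposing [SBS] gives the same identity for [B^T], which spares a proof that the pseudo-inverse
   of a symmetric matrix is symmetric. The factor [A^T] is then cancelled because a real [D] with
   [D^T *m D = 0] vanishes. *)
have SBTS : S *m B^T *m S = S.
  by have := congr1 trmx SBS; rewrite !trmx_mul ST mulmxA.
have ABTS : A *m B^T *m S = A.
  apply/eqP; rewrite -subr_eq0.
  set D := _ - _.
  have AD : A^T *m D = 0 by rewrite /D mulmxBr !mulmxA -SE SBTS subrr.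
  have DT : D^T = S *m B *m A^T - A^T by rewrite /D linearB /= !trmx_mul trmxK ST mulmxA.
  have : D^T *m D = 0 by rewrite DT mulmxBl -[X in X - _]mulmxA AD mulmx0 subrr.
  move=> DD; apply/eqP/matrixP => i j; rewrite [RHS]mxE.
  move/matrixP/(_ j j) : DD; rewrite !mxE => /eqP.
  rewrite psumr_eq0 => [/allP/(_ i)|k _]; last by rewrite mxE -expr2 sqr_ge0.
  by rewrite mem_index_enum !mxE -expr2 sqrf_eq0 => /(_ isT)/eqP.
by rewrite -[RHS](congr1 trmx ABTS) !trmx_mul trmxK ST mulmxA.
Qed.

(** By the symmetry of [B *m S], the matrix [B *m S] equals [S *m B^T], so the range of
    [B = B *m S *m B] lies in that of [S]. Hence the least squares estimate is supported on [M]. *)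
Lemma pinv_model_mx M : let S := model_mx R M *m X^T *m X *m model_mx R M in
  model_mx R M *m Defs.pinv S = Defs.pinv S.
Proof.
set D := model_mx R M => S; have [SBS BSB SB BS] := Defs.pinvP S.
set B := Defs.pinv S in SBS BSB SB BS *.
have ST : S^T = S by rewrite /S !trmx_mul trmxK tr_model_mx !mulmxA.
have DS : D *m S = S by rewrite /S !mulmxA model_mxK.
clearbody B; clearbody S.
have DBS : D *m (B *m S) = B *m S.
  by rewrite -BS trmx_mul ST mulmxA DS.
by rewrite -BSB mulmxA DBS.
Qed.

Lemma X_lse M y : X *m lse X M y = fit M (lse X M y).
Proof. by rewrite /fit /lse; congr (X *m _); rewrite !mulmxA pinv_model_mx. Qed.

Lemma lse_normal_eq M y b : dotmx (y - X *m lse X M y) (fit M b) = 0.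
Proof.
rewrite X_lse; set A := X *m model_mx R M.
have AT : A^T = model_mx R M *m X^T by rewrite trmx_mul tr_model_mx.
have lE : lse X M y = Defs.pinv (A^T *m A) *m A^T *m y.
  by rewrite /lse AT /A !mulmxA.
have fA c : fit M c = A *m c by rewrite /fit mulmxA.
have dotE (u v : 'cV[R]_n) : dotmx u v = (u^T *m v) ord0 ord0.
  by rewrite !mxE; apply: eq_bigr => i _; rewrite mxE.
rewrite dotC !fA dotE trmx_mul -mulmxA lE; clearbody A.
rewrite mulmxBr !mulmxA pinv_normal_eq subrr mulmx0.
by rewrite mxE.
Qed.

Lemma lse_pythagoras M y b :
  normsq (y - fit M b) = normsq (y - X *m lse X M y) + normsq (X *m lse X M y - fit M b).
Proof.
set f := X *m _; have -> : y - fit M b = (y - f) + (f - fit M b) by rewrite addrA subrK.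
rewrite normsqD; suff -> : dotmx (y - f) (f - fit M b) = 0 by rewrite mulr0 addr0.
by rewrite dotDr dotNr lse_normal_eq {2}/f X_lse lse_normal_eq subrr.
Qed.

Lemma lse_min M y b : normsq (y - X *m lse X M y) <= normsq (y - fit M b).
Proof. by rewrite (lse_pythagoras M y b) lerDl normsq_ge0. Qed.

(** One family serves all submodels: when [M] is a union of two models, it contains fits on both,
    hence their difference. *)
Lemma orthonormal_cols M : exists U,
  [/\ orthonormal U, (size U <= #|M|)%N &
     forall M' b, M' \subset M -> in_span U (fit M' b)].
Proof.
have [U [oU sU spU]] := gram_schmidt [seq col i X | i <- enum M].
exists U; split => //; first by rewrite (leq_trans sU)// size_map -cardE.
move=> M' b /fintype.subsetP sM; rewrite fitE; apply: in_span_sum => i iM.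
apply: in_spanZ; apply: spU; apply: map_f; rewrite mem_enum; exact: sM.
Qed.

Lemma fit_full M b : (forall i, i \notin M -> b i ord0 = 0) -> X *m b = fit M b.
Proof.
move=> bM; rewrite /fit; congr (X *m _); apply/matrixP => i j.
rewrite (ord1 j) model_mxE; case: (boolP (i \in M)) => iM; first by rewrite mul1r.
by rewrite mul0r bM.
Qed.

(** Any [\rank X] columns are independent and so span the whole column space. This lets one
    representative stand for all saturated models. *)
Lemma fit_saturated M b : columns_free X -> #|M| = \rank X ->
  exists b', X *m b = fit M b'.
Proof.
move=> Xfree cM.
pose f (i : 'I_(\rank X)) : 'I_p := enum_val (cast_ord (esym cM) i).
have finj : injective f by move=> i j /enum_val_inj/cast_ord_inj.
have := Xfree f finj; rewrite /row_free mxrank_tr => /eqP rf.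
pose A := X *m model_mx R M.
have colA : colsub f X = A *m colsub f 1%:M.
  apply/matrixP => i j; rewrite !mxE (bigD1 (f j))//= big1 => [|k kf].
    by rewrite /A mul_mx_diag !mxE eqxx enum_valP !mulr1 addr0.
  by rewrite !mxE (negPf kf) mulr0.
have rA : \rank A = \rank X.
  apply/eqP; rewrite eqn_leq mxrankM_maxl/= -{1}rf colA.
  exact: mxrankM_maxl.
have : (X^T <= A^T)%MS.
  have sAX : (A^T <= X^T)%MS by rewrite /A trmx_mul submxMl.
  by rewrite -(geq_leqif (mxrank_leqif_sup sAX)) !mxrank_tr rA.
move=> /submxP[C XC]; exists (C^T *m b).
rewrite /fit !mulmxA -/A; congr (_ *m _).
by rewrite -[LHS]trmxK XC trmx_mul trmxK.
Qed.

End least_squares.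

(** * Risk of penalised least squares selectors *)

Lemma selection_risk (R : realType) d (Omega : measurableType d)
  (P : probability Omega R) n (s : R) (eps : Omega -> 'cV[R]_n)
  (I : finType) (Q : pred I) (U : I -> seq 'cV[R]_n) (pen : I -> R)
  (f : 'cV[R]_n -> 'cV[R]_n) (mu : 'cV[R]_n) (K a t A : R) :
  0 < s -> gaussian_noise P s eps -> measurable_fun setT f ->
  0 < a < 1 -> 0 < t -> 2 * (t / a) * s ^+ 2 < 1 -> 0 <= K -> 0 <= A ->
  (forall i, Q i -> orthonormal (U i)) ->
  (forall y, exists i, [/\ Q i, in_span (U i) (f y - mu) &
     normsq (y - f y) + pen i <= normsq (y - mu) + K]) ->
  \sum_(i | Q i) expR ((size (U i))%:R * (- ln (1 - 2 * (t / a) * s ^+ 2) / 2) -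
     t * pen i - A) <= 1 ->
  ('E_P[fun w => normsq (f (mu + eps w) - mu)%R] <= ((K + A / t + 1 / t) / (1 - a))%:E)%E.
Proof.
move=> s0 Ne mf /andP[a0 a1] t0 ta K0 A0 oU sel sumle; have meps := Ne.1.
have a1' : 0 < 1 - a by rewrite subr_gt0.
pose S i (e : 'cV[R]_n) := \sum_(u <- U i) dotmx u e ^+ 2.
pose k i := expR (- t * pen i - A) / (t * (1 - a)).
have k0 i : 0 <= k i by rewrite divr_ge0 ?expR_ge0// mulr_ge0 ?ltW.
(* A majorant of the loss that is linear in exponentials, so that its expectation is computed term
   by term; the null term [dotmx 0 e] matches the form of [gaussian_sqr_mgf]. *)
pose G e := (K + A / t) / (1 - a) + \sum_(i | Q i) k i * expR (t / a * S i e + dotmx 0 e).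
have fG e : normsq (f (mu + e) - mu) <= G e.
  have [i [Qi spi]] := sel (mu + e).
  set w := f (mu + e) - mu in spi *.
  have -> : mu + e - f (mu + e) = e - w by rewrite opprB addrCA addrA.
  rewrite (addrC mu) addrK normsqB => le1.
  (* Young's inequality in each coordinate of the orthonormal family; the fraction [1 - a] of the
     loss remains on the left. *)
  have le2 : 2 * dotmx e w <= a * normsq w + S i e / a.
    rewrite (dot_in_span e spi) (normsq_in_span spi) !mulr_sumr mulr_suml -big_split/=.
    apply: ler_sum => u _; rewrite -subr_ge0.
    have -> : a * dotmx u w ^+ 2 + dotmx u e ^+ 2 / a - 2 * (dotmx u w * dotmx u e) =
      (a * dotmx u w - dotmx u e) ^+ 2 / a by field; rewrite gt_eqF.
    by rewrite divr_ge0 ?sqr_ge0 ?ltW.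
  (* The index [i] depends on the data. Since [Z <= expR Z], the sum of exponentials over the whole
     family bounds [Z] whichever index is selected, and no measurability of the choice enters. *)
  pose Z := t / a * S i e - t * pen i - A.
  have le3 : Z <= \sum_(j | Q j) expR (t / a * S j e - t * pen j - A).
    rewrite (bigD1 i)//=; apply: (@le_trans _ _ (expR Z)).
      by apply: le_trans (expR_ge1Dx _); rewrite lerDr.
    by rewrite lerDl sumr_ge0// => j _; rewrite expR_ge0.
  have le4 : \sum_(i | Q i) k i * expR (t / a * S i e + dotmx 0 e) =
      (\sum_(j | Q j) expR (t / a * S j e - t * pen j - A)) / (t * (1 - a)).
    rewrite mulr_suml; apply: eq_bigr => j _.
    rewrite /k mulrAC -expRD dot0l addr0; congr (expR _ / _); ring.
  rewrite /G le4.
  have -> : (K + A / t) / (1 - a) +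
      (\sum_(j | Q j) expR (t / a * S j e - t * pen j - A)) / (t * (1 - a)) =
      (K + (A + \sum_(j | Q j) expR (t / a * S j e - t * pen j - A)) / t) / (1 - a).
    by field; rewrite !gt_eqF.
  rewrite ler_pdivlMr//.
  have : S i e / a - pen i <= (A + \sum_(j | Q j) expR (t / a * S j e - t * pen j - A)) / t.
    rewrite ler_pdivlMr//; apply: le_trans (lerD (lexx A) le3).
    by rewrite /Z le_eqVlt; apply/orP; left; apply/eqP; ring.
  lra.
have mdot v : measurable_fun setT (fun w => dotmx v (eps w)) by exact: measurable_dotmx.
have mE i : measurable_fun setT (fun w => (expR (t / a * S i (eps w) + dotmx 0 (eps w))%R)%:E).
  apply/measurable_EFinP; apply: measurableT_comp => //.
  apply: measurable_funD => //; apply: measurable_funM => //.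
  by apply: measurable_sum => v; apply: measurable_funX.
have mf' : measurable_fun setT (fun w => normsq (f (mu + eps w) - mu)).
  apply: measurable_normsq; apply: measurable_addmx => //.
  by apply: (measurableT_comp mf); exact: measurable_addmx.
have sumE w : (\sum_(i | Q i) (k i)%:E * (expR (t / a * S i (eps w) + dotmx 0 (eps w))%R)%:E)%E =
    (\sum_(i | Q i) k i * expR (t / a * S i (eps w) + dotmx 0 (eps w)))%:E.
  by rewrite -sumEFin.
have mG : measurable_fun setT (fun w => (\sum_(i | Q i) (k i)%:E *
    (expR (t / a * S i (eps w) + dotmx 0 (eps w))%R)%:E)%E).
  under eq_fun do rewrite -big_filter.
  by apply: emeasurable_sum => i; exact: emeasurable_funM.
rewrite unlock.
apply: (@le_trans _ _ (\int[P]_w (((K + A / t) / (1 - a))%:E +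
    \sum_(i | Q i) (k i)%:E * (expR (t / a * S i (eps w) + dotmx 0 (eps w))%R)%:E)))%E.
  apply: ge0_le_integral => //.
  - by move=> w _; rewrite lee_fin normsq_ge0.
  - exact/measurable_EFinP.
  - by apply: emeasurable_funD => //.
  - by move=> w _; rewrite sumE -EFinD lee_fin; exact: fG.
have C0 : 0 <= (K + A / t) / (1 - a).
  by rewrite divr_ge0 ?(ltW a1') ?addr_ge0 ?divr_ge0 ?(ltW t0).
rewrite ge0_integralD//; last by move=> w _; rewrite sumE lee_fin sumr_ge0// => i _; rewrite mulr_ge0 ?expR_ge0.
rewrite integral_cst// [X in (_ * X)%E](@probability_setT _ _ _ P) mule1.
under eq_integral do rewrite -big_filter.
rewrite ge0_integral_sum//; last 2 first.
- by move=> i; exact: emeasurable_funM.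
- by move=> i w _; rewrite -EFinM lee_fin mulr_ge0 ?expR_ge0.
rewrite big_filter.
have term i : Q i -> (\int[P]_w ((k i)%:E * (expR (t / a * S i (eps w) + dotmx 0 (eps w))%R)%:E))%E =
    (expR ((size (U i))%:R * (- ln (1 - 2 * (t / a) * s ^+ 2) / 2) -
     t * pen i - A) / (t * (1 - a)))%:E.
  move=> Qi; rewrite ge0_integralZl//; last by rewrite lee_fin.
  rewrite (gaussian_sqr_mgf s0 Ne)//; last 3 first.
  - by rewrite divr_ge0 ?ltW.
  - exact: oU.
  - by apply/allP => u _; rewrite dot0l.
  rewrite -EFinM /k mulrAC -expRD normsqE dot0r mul0r mul0r addr0.
  by congr (expR _ / _)%:E; ring.
under eq_bigr => i Qi do rewrite (term i Qi).
rewrite sumEFin -EFinD lee_fin -mulr_suml.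
have -> : (K + A / t + 1 / t) / (1 - a) = (K + A / t) / (1 - a) + 1 / (t * (1 - a)).
  by field; rewrite !gt_eqF.
by rewrite lerD2l ler_pM2r// invr_gt0 mulr_gt0.
Qed.

(** * Lower bound for the risk over sparse vectors *)

Lemma tilt_sqr (R : realType) n (s : R) (v w y : 'cV[R]_n) : 0 < s ->
  tilt s (v + w) y ^+ 2 =
  tilt s v y * (tilt s (v + 2 *: w) y * expR (normsq w / s ^+ 2)).
Proof.
move=> s0; rewrite /tilt expr2 -!expRD; congr expR.
by rewrite !normsqD !dotDl !dotZl !dotZr normsqZ; field; rewrite gt_eqF.
Qed.

Lemma gaussian_tilt1 (R : realType) d (Omega : measurableType d)
  (P : probability Omega R) n (s : R) (eps : Omega -> 'cV[R]_n) v :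
  0 < s -> gaussian_noise P s eps -> (\int[P]_w (tilt s v (eps w))%:E = 1)%E.
Proof.
move=> s0 Ne; have := gaussian_shift s0 Ne v (g := cst 1) (measurable_cst _) (fun=> ler01).
under [X in _ = X -> _]eq_integral do rewrite /= mulr1.
by move=> <-; rewrite (eq_integral (cst 1%E))// integral_cst// mul1e [X in X = _](@probability_setT _ _ _ P).
Qed.

Lemma ge0_integral_sumr (R : realType) d (T : measurableType d)
  (mu : {measure set T -> \bar R}) (I : finType) (F : I -> T -> R) :
  (forall i, measurable_fun setT (F i)) -> (forall i x, 0 <= F i x) ->
  (\int[mu]_x (\sum_i F i x)%:E = \sum_i \int[mu]_x (F i x)%:E)%E.
Proof.
move=> mF F0; under eq_integral do rewrite -sumEFin.
by rewrite ge0_integral_sum// => i; [exact/measurable_EFinP|move=> x _; rewrite lee_fin].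
Qed.

(** Exchanging [j] and [j'] at coordinate [b] is an involution that preserves [G] and swaps two
    slices, so all slices have the same sum. *)
Lemma sum_ffun_coord (R : realType) (I J : finType) (G : {ffun I -> J} -> R) b j :
  (forall t t' : {ffun I -> J}, (forall i, i != b -> t i = t' i) -> G t = G t') ->
  #|J|%:R * (\sum_(t : {ffun I -> J} | t b == j) G t) = \sum_t G t.
Proof.
move=> GE; rewrite [RHS](partition_big (fun t : {ffun I -> J} => t b) xpredT)//=.
rewrite [RHS](eq_bigr (fun=> \sum_(t : {ffun I -> J} | t b == j) G t)).
  by rewrite sumr_const -[RHS]mulr_natl; congr (_%:R * _); exact: eq_card.
move=> j' _; pose h (t : {ffun I -> J}) :=
  [ffun i => if i == b then tperm j j' (t b) else t i].
have hK : involutive h.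
  move=> t; apply/ffunP => i; rewrite !ffunE eqxx.
  by case: eqP => // ->; rewrite tpermK.
rewrite (reindex_inj (inv_inj hK)); apply: eq_big => t.
  rewrite ffunE eqxx; apply/eqP/eqP => [|->]; last by rewrite tpermL.
  by move=> E; apply/(can_inj (tpermK j j')); rewrite E tpermL.
move=> _; apply: GE => i /negPf ib; by rewrite ffunE ib.
Qed.

Lemma norm0D (R : realType) p (a b : 'cV[R]_p) : (norm0 (a + b)%R <= norm0 a + norm0 b)%N.
Proof.
rewrite /norm0 (leq_trans _ (leq_card_setU _ _))//; apply: subset_leq_card.
apply/fintype.subsetP => i; rewrite !inE mxE; apply: contraR.
by rewrite negb_or !negbK => /andP[/eqP -> /eqP ->]; rewrite addr0.
Qed.

Lemma norm0N (R : realType) p (a : 'cV[R]_p) : norm0 (- a) = norm0 a.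
Proof. by apply: eq_card => i; rewrite !inE mxE oppr_eq0. Qed.

Lemma norm0_delta (R : realType) p (i : 'I_p) : norm0 (delta_mx i ord0 : 'cV[R]_p) = 1.
Proof.
rewrite /norm0 (_ : [set _ | _]%SET = [set i]%SET) ?cards1//.
apply/setP => j; rewrite !inE mxE eqxx andbT.
by case: (j == i); rewrite ?oner_neq0 ?eqxx.
Qed.

Lemma normsq_delta (R : realType) p (i : 'I_p) : normsq (delta_mx i ord0 : 'cV[R]_p) = 1.
Proof.
rewrite /normsq (bigD1 i)//= mxE !eqxx expr1n big1 ?addr0// => j /negPf ji.
by rewrite mxE ji expr0n.
Qed.

Section sparse_lower_bound.
Context (R : realType) d (Omega : measurableType d) (P : probability Omega R).
Context (n p : nat) (s : R) (eps : Omega -> 'cV[R]_n) (X : 'M[R]_(n, p)).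
Context (k m : nat) (c : 'I_k * 'I_m -> 'I_p) (lo hi : R).
Hypotheses (s_gt0 : 0 < s) (eps_normal : gaussian_noise P s eps).
Hypotheses (m_gt1 : (1 < m)%N) (c_inj : injective c).
Hypotheses (lo_gt0 : 0 < lo) (hi_gt0 : 0 < hi).
Hypothesis lowerX : forall b, (norm0 b <= k + k)%N -> lo * normsq b <= normsq (X *m b).
Hypothesis upperX : forall i, normsq (X *m delta_mx i ord0) <= hi.

Let V := {ffun 'I_k -> 'I_m}.
(** As [hi] bounds the squared norm of a column, one atom has squared norm at most s^2 ln m / 2. The
    second moment of its likelihood ratio is then at most the square root of [m], below the number
    [m] of positions to choose from. *)
Let amp : R := s * Num.sqrt (ln m%:R / (2 * hi)).

Let beta (B : {set 'I_k}) (t : V) : 'cV[R]_p :=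
  \sum_(b in B) amp *: delta_mx (c (b, t b)) ord0.

Let m_gt0 : 0 < m%:R :> R. Proof. by rewrite ltr0n ltnW. Qed.

Let lnm_gt0 : 0 < ln m%:R :> R. Proof. by rewrite ln_gt0// ltr1n. Qed.

Let amp2 : amp ^+ 2 = s ^+ 2 * (ln m%:R / (2 * hi)).
Proof. by rewrite exprMn sqr_sqrtr// divr_ge0 ?mulr_ge0 ?(ltW hi_gt0) ?(ltW lnm_gt0). Qed.

Let beta_entry t b : beta [set: 'I_k]%SET t (c (b, t b)) ord0 = amp.
Proof.
rewrite summxE (bigD1 b) ?inE//= !mxE !eqxx mulr1 big1 ?addr0// => b' /andP[_ b'b].
rewrite !mxE; case: eqP => [/c_inj[/eqP]|_]; last by rewrite mulr0.
by rewrite eq_sym (negPf b'b).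
Qed.

Let beta_entry0 (t t' : V) b : t b != t' b -> beta [set: 'I_k]%SET t' (c (b, t b)) ord0 = 0.
Proof.
move=> tt'; rewrite summxE big1// => b' _; rewrite !mxE.
case: eqP => [/c_inj[bb' ttb]|_]; last by rewrite mulr0.
by move: tt'; rewrite ttb bb' eqxx.
Qed.

Let norm0_beta (t : V) : (norm0 (beta [set: 'I_k]%SET t) <= k)%N.
Proof.
rewrite (@leq_trans #|[set c (b, t b) | b : 'I_k]%SET|)//; last first.
  by rewrite (leq_trans (leq_imset_card _ _))// card_ord.
apply: subset_leq_card; apply/fintype.subsetP => i; rewrite inE => bi0.
apply/imsetP; case: (boolP [exists b, i == c (b, t b)]) => [/existsP[b /eqP]|].
  by exists b.
rewrite negb_exists => /forallP H; move: bi0; rewrite summxE big1 ?eqxx// => b _.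
by rewrite !mxE (negPf (H b)) mulr0.
Qed.

(** A block where [t] and [t'] differ contributes two entries of the difference; only the one chosen
    by [t] is counted. *)
Let betaB_ge (t t' : V) :
  amp ^+ 2 * #|[set b | t b != t' b]%SET|%:R <= normsq (beta [set: 'I_k]%SET t - beta [set: 'I_k]%SET t').
Proof.
set D := [set b | _]%SET; pose h b := c (b, t b).
have hinj : {in D &, injective h} by move=> b b' _ _ /c_inj[].
rewrite /normsq (bigID [pred i | i \in (h @: D)%SET])/=.
rewrite big_imset//= (eq_bigr (fun=> amp ^+ 2)).
  rewrite sumr_const mulr_natr lerDl sumr_ge0// => i _; exact: sqr_ge0.
move=> b; rewrite inE => tb; rewrite mxE [X in _ + X]mxE.
by rewrite beta_entry (beta_entry0 tb) subr0.
Qed.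

Let mean (t : V) : 'cV[R]_n := X *m beta [set: 'I_k]%SET t.
Let mean_but b (t : V) : 'cV[R]_n := X *m beta [set~ b]%SET t.
Let atom b (t : V) : 'cV[R]_n := amp *: (X *m delta_mx (c (b, t b)) ord0).

Let meanE b (t : V) : mean t = mean_but b t + atom b t.
Proof.
rewrite /mean /mean_but /atom scalemxAr -mulmxDr; congr (X *m _).
rewrite /beta (bigD1 b) ?inE//= addrC; congr (_ + _).
by apply: eq_bigl => i; rewrite !inE.
Qed.

Let atom_le b (t : V) : expR (normsq (atom b t) / s ^+ 2) <= 3 / 4 * m%:R.
Proof.
pose x : R := expR (ln m%:R / 2).
have x2 : x ^+ 2 = m%:R by rewrite /x -expRM_natl mulrCA divff// mulr1 lnK.
have x0 : 0 < x by exact: expR_gt0.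
have m2 : 2 <= m%:R :> R by rewrite ler_nat.
(* Here [x] is the square root of [m], and x <= 3/4 x^2 holds once x >= 4/3, hence from m = 2 on. *)
apply: (@le_trans _ _ x); last by rewrite -x2 in m2 *; nra.
rewrite ler_expR normsqZ amp2 ler_pdivrMr ?exprn_gt0//.
have -> : ln m%:R / 2 * s ^+ 2 = s ^+ 2 * (ln m%:R / (2 * hi)) * hi.
  by field; rewrite gt_eqF.
by rewrite ler_wpM2l// mulr_ge0 ?sqr_ge0// divr_ge0 ?mulr_ge0 ?(ltW hi_gt0) ?(ltW lnm_gt0).
Qed.

Let kappa := lo * amp ^+ 2 / 4.

Let kappa_gt0 : 0 < kappa.
Proof. by rewrite /kappa amp2 !mulr_gt0 ?invr_gt0 ?mulr_gt0. Qed.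

(* psi is the minimum distance decoding of z: by the triangle inequality, |z - mean t| is at
   least half the distance between mean t and mean psi. *)
Let loss_ge z : exists psi : V, forall t : V,
  kappa * #|[set b | t b != psi b]%SET|%:R <= normsq (z - mean t).
Proof.
pose t0 : V := [ffun=> Ordinal (ltnW m_gt1)].
have [psi _ H] := @arg_minP _ R V t0 xpredT (fun t : V => normsq (z - mean t)) isT.
exists psi => t; have Ht := H t isT.
have lB := lowerX (leq_trans (norm0D (beta [set: 'I_k]%SET t) (- beta [set: 'I_k]%SET psi))
  (leq_add (norm0_beta t) (etrans (congr1 (leq^~ k) (norm0N _)) (norm0_beta psi)))).
have tri := normsqB_le2 (mean t) (mean psi) z.
move: lB; rewrite mulmxBr -/(mean t) -/(mean psi) => lB.
have := ler_wpM2l (ltW lo_gt0) (betaB_ge t psi).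
rewrite /kappa; lra.
Qed.

Let L (v e : 'cV[R]_n) := tilt s v e.

(* For each block b the likelihood x of t is compared with the likelihood y of t without b:
   x <= m y / 2 + x^2 / (2 m y) where t b = psi b. The first term does not depend on t b, so
   summing it over those t gives 1/2 of its total, whatever psi is; the second term has
   expectation exp (|atom|^2 / s^2) / (2 m) <= 3/8. No measurability of psi is needed. *)
Let pointwise z e : kappa * k%:R * (\sum_(t : V) L (mean t) e) <=
  (\sum_(t : V) L (mean t) e * normsq (z - mean t)) +
  kappa * \sum_b ((\sum_(t : V) L (mean_but b t) e) / 2 +
     3 / 8 * \sum_(t : V) L (mean_but b t + 2 *: atom b t) e).
Proof.
have [psi psiP] := loss_ge z.
have L0 v : 0 < L v e := tilt_gt0 s v e.
have step b : \sum_(t : V) L (mean t) e <= \sum_(t : V) L (mean t) e * (t b != psi b)%:R +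
    ((\sum_(t : V) L (mean_but b t) e) / 2 + 3 / 8 * \sum_(t : V) L (mean_but b t + 2 *: atom b t) e).
  have avg : m%:R * (\sum_(t : V | t b == psi b) L (mean_but b t) e) =
      \sum_(t : V) L (mean_but b t) e.
    rewrite -{1}(card_ord m); apply: sum_ffun_coord => t t' tt'.
    congr (L _ e); congr (X *m _); apply: eq_bigr => b'; rewrite !inE => bb'.
    by rewrite tt'.
  have avg2 : (\sum_(t : V) L (mean_but b t) e) / 2 =
      \sum_(t : V) (t b == psi b)%:R * (m%:R / 2 * L (mean_but b t) e).
    rewrite -avg big_mkcond mulr_sumr mulr_suml; apply: eq_bigr => t _.
    by case: (t b == psi b) => /=; ring.
  rewrite avg2 mulr_sumr -!big_split/=; apply: ler_sum => t _.
  case: eqP => [tb|_] /=; last first.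
    by rewrite mulr1 mul0r add0r lerDl mulr_ge0// ltW.
  rewrite mulr0 add0r mul1r (meanE b).
  (* In this identity the last likelihood [w] again integrates to 1, which makes the quadratic term
     of the comparison linear in likelihoods. *)
  have := tilt_sqr (mean_but b t) (atom b t) e s_gt0; rewrite -/(L _ e).
  have := atom_le b t.
  set x := L (_ + atom b t) e; set y := tilt s (mean_but b t) e.
  set w := tilt _ _ _; set q := expR _ => qm xyw.
  have x0 : 0 < x := L0 _; have y0 : 0 < y := L0 _; have w0 : 0 < w := L0 _.
  change (x <= m%:R / 2 * y + 3 / 8 * w).
  have xle : x ^+ 2 <= y * (w * (3 / 4 * m%:R)).
    by rewrite xyw !ler_wpM2l// ltW.
  have my0 : 0 < m%:R * y by rewrite mulr_gt0.
  rewrite -(ler_pM2l my0) -subr_ge0.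
  have -> : m%:R * y * (m%:R / 2 * y + 3 / 8 * w) - m%:R * y * x =
      ((x - m%:R * y) ^+ 2 + (y * (w * (3 / 4 * m%:R)) - x ^+ 2)) / 2 by field.
  by rewrite divr_ge0// addr_ge0 ?sqr_ge0 ?subr_ge0.
have sumstep := ler_sum (index_enum 'I_k) (fun b (_ : xpredT b) => step b).
move: sumstep; rewrite sumr_const card_ord big_split/= -[X in X <= _]mulr_natl => H.
have := ler_wpM2l (ltW kappa_gt0) H; rewrite mulrA mulrDr.
move/le_trans; apply; rewrite lerD2r exchange_big/= mulr_sumr.
apply: ler_sum => t _; rewrite -mulr_sumr mulrCA; rewrite ler_wpM2l ?(ltW (L0 _))//.
apply: le_trans (psiP t); rewrite ler_wpM2l ?(ltW kappa_gt0)//.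
rewrite -natr_sum ler_nat -sum1_card [X in (_ <= X)%N]big_mkcond/= leq_sum// => b _.
by rewrite inE; case: (_ == _).
Qed.

Let mean_integral z : (\int[P]_w (L z (eps w))%:E = 1)%E.
Proof. exact: gaussian_tilt1. Qed.

Lemma sparse_lower_bound (f : 'cV[R]_n -> 'cV[R]_n) : measurable_fun setT f ->
  ((lo / hi * s ^+ 2 * (k%:R * ln m%:R) / 64)%:E <= max_risk P eps X k f)%E.
Proof.
move=> mf; have meps := eps_normal.1.
set M := max_risk P eps X k f.
have riskle (t : V) : (risk P eps X f (beta [set: 'I_k]%SET t) <= M)%E.
  by apply: ereal_sup_ubound; exists (beta [set: 'I_k]%SET t) => //; exact: norm0_beta.
have mL v : measurable_fun setT (fun w => L v (eps w)).
  exact: (measurableT_comp (measurable_tilt s v)).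
have L0 v e : 0 <= L v e by rewrite ltW ?tilt_gt0.
have mN v : measurable_fun setT (fun y : 'cV[R]_n => normsq (f y - v)).
  by apply: measurable_normsq; apply: measurable_addmx.
(* The change of mean expresses the risks of all signals under the same noise, so that [pointwise]
   can be integrated. *)
have riskE (t : V) : risk P eps X f (beta [set: 'I_k]%SET t) =
    (\int[P]_w (L (mean t) (eps w) * normsq (f (eps w) - mean t))%:E)%E.
  rewrite /risk unlock -(gaussian_shift s_gt0 eps_normal (mean t) (mN (mean t)))//.
  by move=> y; exact: normsq_ge0.
pose N := #|V|%:R : R.
have N0 : 0 < N by rewrite ltr0n; apply/card_gt0P; exists [ffun=> Ordinal (ltnW m_gt1)].
have intL (F : V -> 'cV[R]_n) : (\int[P]_w (\sum_(t : V) L (F t) (eps w))%:E = N%:E)%E.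
  rewrite ge0_integral_sumr//; under eq_bigr do rewrite mean_integral.
  by rewrite sumEFin sumr_const.
have intL' (F : 'I_k -> V -> 'cV[R]_n) (G : 'I_k -> V -> 'cV[R]_n) :
   (\int[P]_w (\sum_b ((\sum_(t : V) L (F b t) (eps w)) / 2 +
     3 / 8 * \sum_(t : V) L (G b t) (eps w)))%:E = (k%:R * (7 / 8 * N))%:E)%E.
  have msum (H : V -> 'cV[R]_n) : measurable_fun setT (fun w => \sum_(t : V) L (H t) (eps w)).
    exact: measurable_sum.
  have sum0 (H : V -> 'cV[R]_n) w : 0 <= \sum_(t : V) L (H t) (eps w) by exact: sumr_ge0.
  rewrite ge0_integral_sumr; last 2 first.
  - by move=> b; apply: measurable_funD; apply: measurable_funM.
  - by move=> b w; rewrite addr_ge0 ?mulr_ge0.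
  rewrite (eq_bigr (fun=> (7 / 8 * N)%:E)).
    by rewrite sumEFin sumr_const card_ord; congr EFin; rewrite -[LHS]mulr_natl.
  move=> b _; under eq_integral do rewrite EFinD mulrC !EFinM.
  rewrite ge0_integralD//; last 4 first.
  - by move=> w _; rewrite mule_ge0// lee_fin.
  - by apply: emeasurable_funM => //; exact/measurable_EFinP.
  - by move=> w _; rewrite mule_ge0// lee_fin.
  - by apply: emeasurable_funM => //; exact/measurable_EFinP.
  rewrite !ge0_integralZl// ?intL; try by [exact/measurable_EFinP|move=> w _; rewrite lee_fin|rewrite lee_fin].
  by rewrite -!EFinM -EFinD; congr EFin; field.
have main : ((kappa * k%:R * N)%:E <= \sum_(t : V) risk P eps X f (beta [set: 'I_k]%SET t) +
    (kappa * (k%:R * (7 / 8 * N)))%:E)%E.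
  have mterm (t : V) : measurable_fun setT
      (fun w => L (mean t) (eps w) * normsq (f (eps w) - mean t)).
    by apply: measurable_funM => //; exact: (measurableT_comp (mN (mean t))).
  have term0 (t : V) w : 0 <= L (mean t) (eps w) * normsq (f (eps w) - mean t).
    by rewrite mulr_ge0 ?normsq_ge0.
  pose B w := \sum_b ((\sum_(t : V) L (mean_but b t) (eps w)) / 2 +
     3 / 8 * \sum_(t : V) L (mean_but b t + 2 *: atom b t) (eps w)).
  have B0 w : 0 <= B w.
    by apply: sumr_ge0 => b _; rewrite addr_ge0 ?mulr_ge0 ?sumr_ge0.
  have mB : measurable_fun setT B.
    apply: measurable_sum => b; apply: measurable_funD; apply: measurable_funM => //;
      exact: measurable_sum.
  have k0 : 0 <= kappa * k%:R by rewrite mulr_ge0 ?(ltW kappa_gt0).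
  have mS : measurable_fun setT (fun w => \sum_(t : V) L (mean t) (eps w)).
    exact: measurable_sum.
  have S0 w : 0 <= \sum_(t : V) L (mean t) (eps w) by exact: sumr_ge0.
  rewrite EFinM -(intL mean) -ge0_integralZl//; last 2 first.
  - exact/measurable_EFinP.
  - by move=> w _; rewrite lee_fin.
  apply: (@le_trans _ _ (\int[P]_w ((\sum_(t : V) L (mean t) (eps w) *
     normsq (f (eps w) - mean t))%:E + (kappa * B w)%:E))%E).
    apply: ge0_le_integral => //.
    - by move=> w _; rewrite -EFinM lee_fin mulr_ge0.
    - by apply: emeasurable_funM => //; exact/measurable_EFinP.
    - apply: emeasurable_funD; apply/measurable_EFinP; last exact: measurable_funM.
      exact: measurable_sum.
    - by move=> w _; rewrite -EFinM -EFinD lee_fin; exact: pointwise.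
  rewrite ge0_integralD//; last 4 first.
  - by move=> w _; rewrite lee_fin sumr_ge0.
  - by apply/measurable_EFinP; exact: measurable_sum.
  - by move=> w _; rewrite lee_fin mulr_ge0// ltW.
  - by apply/measurable_EFinP; exact: measurable_funM.
  rewrite ge0_integral_sumr//; apply: leeD.
    by apply: lee_sum => t _; rewrite riskE.
  under eq_integral do rewrite EFinM.
  rewrite ge0_integralZl//; last 3 first.
  - exact/measurable_EFinP.
  - by move=> w _; rewrite lee_fin.
  - by rewrite lee_fin ltW.
  by rewrite intL' -EFinM.
have M0 : (0 <= M)%E.
  apply: le_trans (riskle [ffun=> Ordinal (ltnW m_gt1)]).
  by rewrite riskE; apply: integral_ge0 => w _; rewrite lee_fin mulr_ge0 ?normsq_ge0.
case: M M0 riskle => [M||//] _ riskle; last exact: leey.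
have sumle : (\sum_(t : V) risk P eps X f (beta [set: 'I_k]%SET t) <= (N * M)%:E)%E.
  apply: (@le_trans _ _ (\sum_(t : V) M%:E)%E); first by apply: lee_sum => t _; exact: riskle.
  by rewrite sumEFin sumr_const mulr_natl.
have := le_trans main (leeD sumle (lexx _)).
rewrite -EFinD !lee_fin => Mge.
(* The share 1/2 + 3/8 = 7/8 bounds correct decoding and leaves 1/8. With the 1/4 in [kappa] and the
   1/2 in [amp2] this gives the constant 1/64. *)
have : kappa * k%:R / 8 <= M by rewrite -(ler_pM2l N0); lra.
apply: le_trans; rewrite /kappa amp2 le_eqVlt; apply/orP; left; apply/eqP.
by field; rewrite gt_eqF.
Qed.

End sparse_lower_bound.

(** * Logarithms, binomial coefficients and the rate *)

Section real_bounds.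
Context (R : realType).

Lemma ln2_ge_half : 1 / 2 <= ln 2 :> R.
Proof.
rewrite -[X in X <= _](@expRK R) ler_ln ?posrE ?expR_gt0//.
have := expR_ge1Dx (- (1 / 2) : R); rewrite expRN => h.
have e0 : 0 < expR (1 / 2) :> R := expR_gt0 _.
have := ler_wpM2r (ltW e0) h; rewrite mulVf ?gt_eqF//; lra.
Qed.

Lemma ln2_le1 : ln 2 <= 1 :> R.
Proof. by have := @le_ln1Dx R 1; rewrite -[1 + 1]/(2 : R); apply; lra. Qed.

Lemma ln_bin_le p k : (0 < k <= p)%N ->
  ln ('C(p, k)%:R : R) <= k%:R * (ln (p%:R / k%:R) + 1).
Proof.
move=> /andP[k0 kp]; have p0 : (0 < p)%N by exact: leq_trans kp.
have kR : 0 < k%:R :> R by rewrite ltr0n.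
have pR : 0 < p%:R :> R by rewrite ltr0n.
have x0 : 0 < k%:R / p%:R :> R by rewrite divr_gt0.
have cR : 0 < 'C(p, k)%:R :> R by rewrite ltr0n bin_gt0.
(* one term of the binomial expansion of (1 + k/p)^p <= e^k *)
have : 'C(p, k)%:R * (k%:R / p%:R) ^+ k <= expR k%:R :> R.
  apply: (@le_trans _ _ ((1 + k%:R / p%:R) ^+ p)).
    rewrite exprDn (bigD1 (Ordinal (kp : (k < p.+1)%N)))//= expr1n mul1r mulr_natl.
    rewrite lerDl sumr_ge0// => i _; rewrite mulrn_wge0// mulr_ge0 ?exprn_ge0// ltW//.
  have -> : expR k%:R = expR (k%:R / p%:R) ^+ p :> R.
    by rewrite -expRM_natl mulrCA divff ?mulr1// gt_eqF.
  by apply: lerXn2r; rewrite ?nnegrE ?expR_ge0 ?expR_ge1Dx// addr_ge0 ?ltW.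
rewrite -(@ler_ln R) ?posrE ?expR_gt0 ?mulr_gt0 ?exprn_gt0//.
rewrite lnM ?posrE ?exprn_gt0// lnXn// expRK.
rewrite !ln_div ?posrE// -mulr_natl; lra.
Qed.

Lemma ln_ratio_ge0 p k : (0 < k <= p)%N -> 0 <= ln (p%:R / k%:R : R).
Proof.
move=> /andP[k0 kp]; rewrite ln_ge0// ler_pdivlMr ?ltr0n//.
by rewrite mul1r ler_nat.
Qed.

(** Selects the model size [k] that realises the rate: [p0], or the saturated size. At p0 = r the
    minimum is already [r], so the logarithmic case can be kept to k < r, where the penalty has its
    binomial factor. *)
Lemma rate_cases p r p0 : (0 < p0 <= r)%N -> (r <= p)%N -> exists k, [/\
  (p0 <= k <= r)%N & (k < r)%N && (rate R p r p0 == k%:R * (ln (p%:R / k%:R) + 1))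
    || (k == r) && (rate R p r p0 == r%:R)].
Proof.
move=> /andP[p00 p0r] rp; rewrite /rate.
have := p0r; rewrite leq_eqVlt => /orP[/eqP p0E|p0lt].
  exists r; rewrite p0r leqnn eqxx/= ltnn/=; split => //.
  rewrite p0E min_r// ler_peMr ?ler0n//.
  by rewrite lerDr; apply: ln_ratio_ge0; rewrite -{1}p0E p00 rp.
case: (leP (p0%:R * (ln (p%:R / p0%:R) + 1)) (r%:R : R)) => h.
  by exists p0; rewrite leqnn p0r p0lt eqxx.
by exists r; rewrite p0r leqnn !eqxx orbT.
Qed.

(** Let m be the integer part of p/k. If p0 <= r/2, then p/k <= m + 1 <= m^2 and ln m >= 1/2 absorbs
    the added 1. Otherwise r <= 3k, and ln m >= 1/2 turns 3k into 6 k ln m. *)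
Lemma rate_le_blocks p r p0 (k := minn p0 r./2) : (2 <= r <= p)%N -> (0 < p0 <= r)%N ->
  rate R p r p0 <= 6 * (k%:R * ln (p %/ k)%:R).
Proof.
move=> /andP[r2 rp] /andP[p00 p0r].
have k0 : (0 < k)%N by rewrite leq_min p00 half_gt0.
have kp : (k * 2 <= p)%N.
  rewrite (leq_trans _ rp)// (@leq_trans (r./2 * 2))//; first by rewrite leq_mul2r geq_minr.
  by rewrite muln2 -[leqRHS]odd_double_half leq_addl.
have m2 : (2 <= p %/ k)%N by rewrite leq_divRL// mulnC.
set m := (p %/ k)%N in m2 *.
have mR : 2 <= m%:R :> R by rewrite ler_nat.
have kR : 0 < k%:R :> R by rewrite ltr0n.
have lnm : 1 / 2 <= ln m%:R :> R.
  by apply: le_trans ln2_ge_half _; rewrite ler_ln ?posrE//; lra.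
have klnm : k%:R <= 2 * (k%:R * ln m%:R) :> R by nra.
rewrite /rate; case: (leqP p0 r./2) => h.
  have kE : k = p0 by apply/minn_idPl.
  rewrite ge_min; apply/orP; left; rewrite -kE.
  have pk : p%:R / k%:R <= m%:R + 1 :> R.
    rewrite ler_pdivrMr// natr1 -natrM ler_nat ltnW// ltn_ceil//.
  have lnp : ln (p%:R / k%:R) <= 2 * ln m%:R :> R.
    rewrite [leRHS]mulr_natl -lnXn; last by lra.
    have p0' : 0 < p%:R :> R by rewrite ltr0n (leq_trans _ rp)// (leq_trans _ r2).
    rewrite ler_ln ?posrE ?divr_gt0 ?exprn_gt0//; last by lra.
    by apply: le_trans pk _; nra.
  nra.
have kE : k = r./2 by apply/minn_idPr; exact: ltnW.
rewrite ge_min; apply/orP; right.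
apply: (@le_trans _ _ (3 * k%:R)); last by nra.
rewrite -natrM ler_nat kE.
have := odd_double_half r; have : (0 < r./2)%N by rewrite half_gt0.
by case: (odd r) => /=; rewrite -muln2; lia.
Qed.

End real_bounds.

(** * Sparse eigenvalues *)

Section sparse_eigenvalues.
Context (R : realType) (n p : nat) (X : 'M[R]_(n, p)).

Lemma norm0_eq0 (b : 'cV[R]_p) : (norm0 b == 0)%N = (b == 0).
Proof.
rewrite cards_eq0; apply/eqP/eqP => [b0|->].
  apply/matrixP => i j; rewrite (ord1 j) mxE; apply/eqP.
  by move/setP/(_ i) : b0; rewrite !inE => /negbFE.
by apply/setP => i; rewrite !inE mxE eqxx.
Qed.

Lemma tau_sparse_eigen (c : R) r : 0 < c -> c <= tau X r -> exists lo hi : R,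
  [/\ 0 < lo, 0 < hi, c <= lo / hi & forall b, (norm0 b <= r)%N ->
     lo * normsq b <= normsq (X *m b) <= hi * normsq b].
Proof.
move=> c0 ctau; exists (phi_min X r), (phi_max X r).
have ray0 x : rayleigh X r x -> 0 <= x.
  by move=> [b _ <-]; rewrite divr_ge0 ?normsq_ge0.
have tau0 : 0 < phi_min X r / phi_max X r by exact: lt_le_trans ctau.
(* The default value of [sup] is 0 and the inverse of 0 is 0, so a positive [tau] certifies that the
   Rayleigh quotients do have a supremum. *)
have max_neq0 : phi_max X r != 0.
  by apply: contraTneq tau0 => ->; rewrite invr0 mulr0 ltxx.
have hs : has_sup (rayleigh X r).
  by apply: contrapT => /sup_out h; move: max_neq0; rewrite /phi_max h eqxx.
have max_gt0 : 0 < phi_max X r.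
  rewrite lt_def max_neq0/=; have [[x xr] ub] := hs.
  exact: le_trans (ray0 _ xr) (ub_le_sup ub xr).
have min_gt0 : 0 < phi_min X r by move: tau0; rewrite pmulr_lgt0// invr_gt0.
split => // b br; case: (eqVneq b 0) => [->|b0].
  by rewrite mulmx0 normsqE dot0r !mulr0 normsqE dot0r lexx.
have nb : 0 < normsq b by rewrite lt_def normsq_eq0 b0 normsq_ge0.
have rb : rayleigh X r (normsq (X *m b) / normsq b).
  by exists b => //=; rewrite br lt0n norm0_eq0 b0.
have lb : has_lbound (rayleigh X r) by exists 0 => x /ray0.
rewrite -ler_pdivlMr// -[X in _ && X]ler_pdivrMr//.
by rewrite (ge_inf lb rb) (ub_le_sup hs.2 rb).
Qed.

End sparse_eigenvalues.

(** * Upper bound for the minimax risk *)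

Lemma superset_card (T : finType) (A : {set T}) k : (#|A| <= k <= #|T|)%N ->
  exists2 B : {set T}, A \subset B & #|B| = k.
Proof.
move=> /andP[Ak kT]; elim: k Ak kT => [|k IH].
  by rewrite leqn0 => A0 _; exists A => //; apply/eqP.
rewrite leq_eqVlt => /orP[/eqP Ak _|Ak kT]; first by exists A.
have [B AB cB] := IH Ak (ltnW kT).
have /card_gt0P[x] : (0 < #|~: B|)%N by rewrite cardsCs finset.setCK cB subn_gt0.
rewrite inE => xB; exists (x |: B)%SET; first exact: fintype.subset_trans AB (finset.subsetUr _ _).
by rewrite cardsU1 xB cB.
Qed.

Section upper_bounds.
Context (R : realType) (n p : nat) (X : 'M[R]_(n, p)).

(** Adding candidates one at a time makes the selector a finite nest of tests between measurable
    functions. *)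
Lemma measurable_fit_minimizer (M : {set 'I_p}) (Ms : seq {set 'I_p}) :
  exists f : 'cV[R]_n -> 'cV[R]_n, measurable_fun setT f /\
    forall y, (exists2 N, N \in M :: Ms & f y = X *m lse X N y) /\
      {in M :: Ms, forall N, normsq (y - f y) <= normsq (y - X *m lse X N y)}.
Proof.
have mlse N : measurable_fun setT (fun y : 'cV[R]_n => X *m lse X N y).
  by apply: measurable_mulmxr; rewrite /lse; apply: measurable_mulmxr.
elim: Ms => [|N Ms [f [mf fP]]].
  exists (fun y : 'cV[R]_n => X *m lse X M y); split => // y; split; first by exists M; rewrite ?inE.
  by move=> N; rewrite inE => /eqP ->.
pose g y := X *m lse X N y.
have mres (h : 'cV[R]_n -> 'cV[R]_n) : measurable_fun setT h ->
    measurable_fun setT (fun y : 'cV[R]_n => normsq (y - h y)).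
  by move=> mh; apply: measurable_normsq; apply: measurable_addmx => //; exact: measurable_oppmx.
exists (fun y : 'cV[R]_n => if normsq (y - g y) <= normsq (y - f y) then g y else f y); split.
  apply: measurable_fun_ifT => //; last exact: mlse.
  by apply: measurable_fun_ler; apply: mres => //; exact: mlse.
move=> y; have [[N' N'in fE] fmin] := fP y.
have memE N0 : (N0 \in M :: N :: Ms) = (N0 == N) || (N0 \in M :: Ms).
  by rewrite !inE orbCA.
case: ifP => le.
  split; first by exists N; rewrite // memE eqxx.
  move=> N0; rewrite memE => /orP[/eqP ->//|N0in].
  by apply: le_trans le _; exact: fmin.
split; first by exists N'; rewrite // memE N'in orbT.
move=> N0; rewrite memE => /orP[/eqP ->|]; last exact: fmin.
by rewrite ltW// ltNge -/(g y) le.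
Qed.

Lemma sparse_fit (b : 'cV[R]_p) k : (norm0 b <= k <= p)%N ->
  exists2 M : {set 'I_p}, #|M| = k & X *m b = fit X M b.
Proof.
move=> bk; have := @superset_card _ [set i | b i ord0 != 0]%SET k.
rewrite card_ord => /(_ bk) [M bM cM]; exists M => //; apply: fit_full => i.
by apply: contraNeq => bi; apply: (fintype.subsetP bM); rewrite inE.
Qed.

Context d (Omega : measurableType d) (P : probability Omega R).
Context (s : R) (eps : Omega -> 'cV[R]_n).
Hypotheses (s_gt0 : 0 < s) (eps_normal : gaussian_noise P s eps).

Lemma family_risk (Ms : {set {set 'I_p}}) (M0 : {set 'I_p}) k p0 :
  M0 \in Ms -> (forall M, M \in Ms -> #|M| <= k)%N ->
  (forall b, (norm0 b <= p0)%N -> exists M b', M \in Ms /\ X *m b = fit X M b') ->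
  (minimax_risk P eps X p0 <= (16 * s ^+ 2 * (ln #|Ms|%:R + k%:R + 1))%:E)%E.
Proof.
move=> M0in szM sparse.
have [f [mf fP]] := measurable_fit_minimizer M0 (enum Ms).
apply: (@le_trans _ _ (max_risk P eps X p0 f)).
  by apply: ereal_inf_lbound; exists f.
apply: ge_ereal_sup => _ [b bp0 <-].
have [M [b' [Min bE]]] := sparse b bp0; rewrite /risk bE.
(* The spans depend on the unknown mean through [M]; the estimate [f] was fixed before [b] was
   introduced. *)
pose U (N : {set 'I_p}) := sval (cid (orthonormal_cols X (N :|: M))).
have UP N : [/\ orthonormal (U N), (size (U N) <= #|N :|: M|)%N &
    forall (M' : {set 'I_p}) b, M' \subset N :|: M -> in_span (U N) (fit X M' b)].
  exact: svalP (cid (orthonormal_cols X (N :|: M))).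
have szU N : N \in Ms -> (size (U N) <= k + k)%N.
  move=> Nin; have [_ sz _] := UP N; rewrite (leq_trans sz)//.
  by rewrite (leq_trans (leq_card_setU _ _))// leq_add ?szM.
have cMs : 1 <= #|Ms|%:R :> R by rewrite ler1n; apply/card_gt0P; exists M0.
(* With a = 1/2 and t = 1/(8 s^2) each of the at most 2k dimensions costs (ln 2)/2; this [A] brings
   each summand down to [1 / #|Ms|]. *)
pose A : R := ln #|Ms|%:R + k%:R * ln 2.
have A0 : 0 <= A by rewrite addr_ge0 ?ln_ge0// mulr_ge0// ln_ge0 ?ler1n.
have s2 : 0 < s ^+ 2 by rewrite exprn_gt0.
have half : 1 - 2 * ((8 * s ^+ 2)^-1 / (1 / 2)) * s ^+ 2 = 2^-1 :> R.
  by field; rewrite gt_eqF.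
have minE N : N \in M0 :: enum Ms -> N \in Ms.
  by rewrite inE mem_enum => /orP[/eqP ->|].
have := @selection_risk R _ Omega P n s eps _ [pred N | N \in Ms] U (fun=> 0) f
  (fit X M b') 0 (1 / 2) (8 * s ^+ 2)^-1 A s_gt0 eps_normal mf.
move=> H; apply: le_trans (H _ _ _ _ _ _ _ _) _ => {H} //.
- by apply/andP; split; lra.
- by rewrite invr_gt0 mulr_gt0.
- have : (0 : R) < 2^-1 by rewrite invr_gt0.
  move: half; set q := 2 * _ * _; lra.
- by move=> N _; have [] := UP N.
- move=> y; have [[N Nin fE] fmin] := fP y.
  exists N; split; first exact: minE.
    rewrite fE X_lse; have [_ _ spU] := UP N.
    by apply: in_spanB; apply: spU; rewrite ?finset.subsetUl ?finset.subsetUr.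
  rewrite !addr0; apply: le_trans (lse_min X M y b').
  by apply: fmin; rewrite inE mem_enum Min orbT.
- rewrite half lnV ?posrE// opprK.
  rewrite [leRHS](_ : _ = \sum_(N | N \in Ms) (#|Ms|%:R)^-1); last first.
    by rewrite sumr_const -[RHS]mulr_natr mulVf// gt_eqF// (lt_le_trans ltr01).
  apply: ler_sum => N Nin; rewrite mulr0 subr0.
  rewrite -[leRHS]lnK ?posrE ?invr_gt0 ?(lt_le_trans ltr01)// ler_expR lnV ?posrE ?(lt_le_trans ltr01)//.
  have sz : (size (U N))%:R <= k%:R + k%:R :> R by rewrite -natrD ler_nat szU.
  have ln2 : 0 <= ln 2 :> R by rewrite ln_ge0// ler1n.
  by have := ler_wpM2r ln2 sz; rewrite /A; lra.
rewrite lee_fin.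
have -> : (0 + A / (8 * s ^+ 2)^-1 + 1 / (8 * s ^+ 2)^-1) / (1 - 1 / 2) =
   16 * s ^+ 2 * (A + 1) by field; rewrite gt_eqF.
apply: ler_wpM2l; first by rewrite mulr_ge0 ?(ltW s2).
by rewrite lerD2r lerD2l ler_piMr// ln2_le1.
Qed.

Hypothesis X_free : columns_free X.

Lemma minimax_risk_le p0 : (0 < p0 <= \rank X)%N ->
  (minimax_risk P eps X p0 <= (48 * s ^+ 2 * rate R p (\rank X) p0)%:E)%E.
Proof.
move=> p0r; have rp := rank_leq_col X.
have [k [/andP[p0k kr] kE]] := rate_cases R p0r rp.
have p0_gt0 : (0 < p0)%N by case/andP: p0r.
have k1 : 1 <= k%:R :> R by rewrite ler1n (leq_trans p0_gt0).
have s2 : 0 < s ^+ 2 by rewrite exprn_gt0.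
have [M0 _ cM0] : exists2 B : {set 'I_p}, (finset.set0 \subset B) & #|B| = k.
  by apply: superset_card; rewrite cards0 card_ord (leq_trans kr rp).
case/orP: kE => /andP[].
  move=> kltr /eqP ->.
  have H := @family_risk [set M : {set 'I_p} | #|M| == k]%SET M0 k p0.
  apply: le_trans (H _ _ _) _ => {H}.
  - by rewrite inE cM0.
  - by move=> M; rewrite inE => /eqP ->.
  - move=> b bp0; have [] := @sparse_fit b k; first by rewrite (leq_trans bp0 p0k) (leq_trans kr rp).
    by move=> M cM ->; exists M, b; rewrite inE cM.
  have k0p : (0 < k <= p)%N by rewrite (leq_trans p0_gt0 p0k) (leq_trans kr rp).
  rewrite lee_fin card_draws card_ord -mulrA -[leRHS]mulrA.
  have := ln_bin_le R k0p; have := ln_ratio_ge0 R k0p.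
  set q := ln (_ / _) => q0 binle.
  (* The factor 3 arises because the log-binomial, [k] and 1 are each at most [k%:R * (q + 1)]. *)
  have -> : 48 * (s ^+ 2 * (k%:R * (q + 1))) = 16 * (s ^+ 2 * (3 * (k%:R * (q + 1)))) by ring.
  by rewrite !ler_wpM2l// ?(ltW s2)//; nra.
move=> /eqP kr' /eqP ->; have H := @family_risk [set M0]%SET M0 k p0.
apply: le_trans (H _ _ _) _ => {H}.
- by rewrite inE.
- by move=> M; rewrite inE => /eqP ->; rewrite cM0.
- move=> b _; have [b' ->] := fit_saturated b X_free (etrans cM0 kr').
  by exists M0, b'; rewrite inE.
rewrite cards1 ln1 add0r lee_fin -mulrA -[leRHS]mulrA -kr'.
have -> : 48 * (s ^+ 2 * k%:R) = 16 * (s ^+ 2 * (3 * k%:R)) :> R by ring.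
by rewrite !ler_wpM2l// ?(ltW s2)//; lra.
Qed.

End upper_bounds.

(** * Risk of the MAP selector *)

Lemma sum_set_card (R : realType) (T : finType) r (g : nat -> R) :
  \sum_(M : {set T} | (#|M| < r)%N) g #|M| = \sum_(k < r) 'C(#|T|, k)%:R * g k.
Proof.
transitivity (\sum_(k < r) \sum_(M : {set T} | #|M| == k) g k); last first.
  apply: eq_bigr => k _; rewrite sumr_const -(card_draws T k) -[LHS]mulr_natl.
  by congr (_%:R * _); apply: eq_card => M; rewrite !inE.
rewrite (exchange_big_dep (fun M : {set T} => (#|M| < r)%N))/=; last first.
  by move=> k M _ /eqP ->; exact: ltn_ord.
apply: eq_bigr => M Mr; rewrite (bigD1 (Ordinal Mr))//= big1 ?addr0// => k /andP[/eqP Mk].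
by rewrite -val_eqE /= Mk eqxx.
Qed.

Section map_selector_risk.
Context (R : realType) d (Omega : measurableType d) (P : probability Omega R).
Context (n p : nat) (s : R) (eps : Omega -> 'cV[R]_n) (X : 'M[R]_(n, p)).
Context (gamma : R) (pi : nat -> R).
Let r := \rank X.
Hypotheses (s_gt0 : 0 < s) (eps_normal : gaussian_noise P s eps).
Hypotheses (X_free : columns_free X) (gamma_gt0 : 0 < gamma).
Hypotheses (pi_prior : prior r pi) (pi_upper : prior_upper gamma p r pi).

Let rp : (r <= p)%N. Proof. exact: rank_leq_col. Qed.

(** The number of models of size [k], the saturated ones being identified. *)
Let binr k : R := if (k < r)%N then 'C(p, k)%:R else 1.

(** Minus the logarithm of the prior mass of a single model. *)
Let ell k : R := ln (binr k / pi k).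

Let L : R := ln (1 + gamma).

Let L_ge0 : 0 <= L. Proof. by rewrite ln_ge0// lerDl ltW. Qed.

Let binr_gt0 k : (k <= r)%N -> 0 < binr k.
Proof.
move=> kr; rewrite /binr; case: ifP => // _.
by rewrite ltr0n bin_gt0 (leq_trans kr rp).
Qed.

Let ratio_gt0 k : (k <= r)%N -> 0 < binr k / pi k.
Proof. by move=> kr; rewrite divr_gt0 ?binr_gt0// pi_prior.1. Qed.

Let Pen_ell k : (k <= r)%N ->
  Pen s gamma p r pi k = 2 * s ^+ 2 * (1 + 1 / gamma) * (ell k + k%:R / 2 * L).
Proof.
move=> kr; rewrite /Pen -/(binr k) lnM ?posrE ?ratio_gt0 ?powR_gt0 ?addr_gt0//.
by rewrite ln_powR.
Qed.

Let ell_ge k : (k <= r)%N -> c_gamma gamma * k%:R <= ell k.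
Proof.
move=> kr; have pk : 0 < pi k by exact: pi_prior.1.
suff : pi k <= binr k * expR (- (c_gamma gamma * k%:R)).
  move=> h; rewrite /ell -[leLHS]expRK ler_ln ?posrE ?expR_gt0 ?ratio_gt0//; move: h.
  by rewrite expRN ler_pdivlMr ?expR_gt0// ler_pdivlMr// mulrC.
rewrite /binr; case: ltnP => [|rk]; first exact: pi_upper.1.
have -> : k = r by apply/eqP; rewrite eqn_leq kr.
by rewrite mul1r; exact: pi_upper.2.
Qed.

Let c_gamma_ge0 : 0 <= c_gamma gamma.
Proof. by rewrite /c_gamma mulr_ge0 ?sqr_ge0. Qed.

Let Pen_ge0 k : (k <= r)%N -> 0 <= Pen s gamma p r pi k.
Proof.
move=> kr; have g0 : 0 <= 1 + 1 / gamma by rewrite addr_ge0// divr_ge0// ltW.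
rewrite Pen_ell//; apply: mulr_ge0; first by apply: mulr_ge0 => //; apply: mulr_ge0 => //; exact: sqr_ge0.
apply: addr_ge0; last by rewrite !mulr_ge0.
by apply: le_trans (ell_ge kr); rewrite mulr_ge0.
Qed.

(** Equals [- ln (1 - 2 * (t / a) * s ^+ 2)] for the [t] and [a] below, so half of it is the cost of
    one dimension. *)
Let Lam : R := ln (4 * (1 + gamma)).

(* With this t the factor 2 t s^2 (1 + 1/gamma) is 1 + 1/(2 gamma): one copy of the penalty
   pays for the union bound and the prior mass, and the surplus ell/(2 gamma) >= 6 k
   absorbs the factor 4 in Lam. *)
Let t : R := (gamma + 1 / 2) / (2 * s ^+ 2 * (gamma + 1)).
(** Makes 2 (t/a) s^2 = (gamma + 3/4)/(gamma + 1), which is below 1, and 1/(1 - a) = 4 (gamma +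
    3/4). *)
Let a : R := (gamma + 1 / 2) / (gamma + 3 / 4).

Let model_weight k : (k <= r)%N ->
  expR (k%:R * (Lam / 2) - t * Pen s gamma p r pi k) <= pi k / binr k.
Proof.
move=> kr; have pk : 0 < pi k by exact: pi_prior.1.
have -> : pi k / binr k = expR (- ell k).
  by rewrite expRN lnK ?posrE ?ratio_gt0// invf_div.
rewrite ler_expR Pen_ell// /Lam lnM ?posrE ?addr_gt0// -/L.
have -> : t * (2 * s ^+ 2 * (1 + 1 / gamma) * (ell k + k%:R / 2 * L)) =
    (1 + 1 / (2 * gamma)) * (ell k + k%:R / 2 * L).
  by rewrite /t; field; rewrite !gt_eqF ?addr_gt0.
(* The factor (1 + gamma)^(k/2) of the penalty cancels the part [L] of [Lam]; only k (ln 4)/2 is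
   left to the surplus. *)
have ln4 : ln 4 <= 2 :> R.
  have -> : 4 = 2 ^+ 2 :> R by ring.
  by rewrite lnXn// mulr2n; have := @ln2_le1 R; lra.
have h0 : 0 <= 1 / (2 * gamma) by rewrite divr_ge0// mulr_ge0// ltW.
have hell : 6 * k%:R <= 1 / (2 * gamma) * ell k.
  (* Here [c_gamma] acts: (gamma + 3/4)^2 >= 3 gamma gives [c_gamma gamma] >= 24 gamma, more than
     the 12 gamma required. *)
  apply: (@le_trans _ _ (1 / (2 * gamma) * (c_gamma gamma * k%:R))); last first.
    by rewrite ler_wpM2l// ell_ge.
  rewrite mulrA ler_wpM2r// mul1r mulrC ler_pdivlMr ?mulr_gt0// /c_gamma.
  by rewrite -subr_ge0; nra.
have kL : 0 <= 1 / (2 * gamma) * (k%:R / 2 * L).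
  by apply: mulr_ge0 => //; rewrite !mulr_ge0.
have : k%:R * ln 4 <= k%:R * 2 :> R by rewrite ler_wpM2l.
have k0 : 0 <= k%:R :> R by [].
lra.
Qed.

(** The selected model is compared with a model [M0] of the size given by [rate_cases]. In [C] the
    first term is the penalty of [M0], the second is (A + 1)/t, and the last factor is 1/(1 - a). *)
Lemma map_risk_le (c1 c2 : R) (Mhat : 'cV[R]_n -> {set 'I_p}) p0
  (C := (2 * (1 + 1 / gamma) * (1 + c1 + c2 + L) +
         (Lam / 2 + 1) * (2 * (gamma + 1) / (gamma + 1 / 2))) * (4 * (gamma + 3 / 4))) :
  0 <= c1 -> 0 <= c2 -> prior_lower c1 c2 p r pi ->
  map_selector s gamma X pi Mhat -> (0 < p0 <= r)%N ->
  (max_risk P eps X p0 (fitted X Mhat) <= (C * s ^+ 2 * rate R p r p0)%:E)%E.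
Proof.
move=> c10 c20 pi_lower [mfit sel] p0r; apply: ge_ereal_sup => _ [b bp0 <-].
have [k [/andP[p0k kr] kE]] := rate_cases R p0r rp.
have k_gt0 : (0 < k)%N by case/andP: p0r => p0_gt0 _; exact: leq_trans p0k.
have k1 : 1 <= k%:R :> R by rewrite ler1n.
have s2 : 0 < s ^+ 2 by rewrite exprn_gt0.
have [M0 cM0 [b0 bE]] : exists2 M0 : {set 'I_p}, #|M0| = k &
    exists b0, X *m b = fit X M0 b0.
  have [] := @sparse_fit _ _ _ X b k.
    by rewrite (leq_trans bp0 p0k) (leq_trans kr rp).
  by move=> M cM ->; exists M => //; exists b.
have [Ms _ cMs] : exists2 B : {set 'I_p}, (finset.set0 \subset B) & #|B| = r.
  by apply: superset_card; rewrite cards0 card_ord rp.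
(* The lower bounds on the prior keep the penalty of [M0] of the order of the rate: [c1] serves the
   sizes below r, [c2] the saturated one. *)
have [k_le_rate ell_le] : k%:R <= rate R p r p0 /\
    ell k <= (1 + c1 + c2) * rate R p r p0.
  have pk : 0 < pi k by exact: pi_prior.1.
  case/orP: kE => /andP[].
    move=> kltr /eqP ->; have k0p : (0 < k <= p)%N by rewrite k_gt0 (leq_trans kr rp).
    have kR : 0 < k%:R :> R by rewrite ltr0n.
    have pR : 0 < p%:R :> R by rewrite ltr0n (leq_trans k_gt0)// (leq_trans kr).
    have pige : c1 * k%:R * (ln k%:R - (ln p%:R + 1)) <= ln (pi k).
      have := pi_lower.1 k; rewrite k_gt0 kltr => /(_ isT).
      rewrite -[X in is_true X -> _]ler_ln ?posrE ?powR_gt0 ?divr_gt0 ?mulr_gt0 ?expR_gt0// ln_powR.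
      by rewrite ln_div ?posrE ?mulr_gt0 ?expR_gt0// lnM ?posrE ?expR_gt0// expRK.
    have := ln_ratio_ge0 R k0p; have := ln_bin_le R k0p.
    rewrite ln_div ?posrE// /ell /binr kltr ln_div ?posrE ?ltr0n ?bin_gt0 ?(leq_trans kr rp)//.
    move: pige; set lp := ln p%:R; set lk := ln k%:R => pige binle q0.
    split; first by nra.
    have : 0 <= c2 * (k%:R * (lp - lk + 1)) by rewrite !mulr_ge0// addr_ge0.
    lra.
  move=> /eqP kE' /eqP ->; split; first by rewrite kE'.
  rewrite /ell /binr kE' ltnn mul1r lnV ?posrE -?kE'//.
  have := pi_lower.2; rewrite -kE' -[X in is_true X -> _]ler_ln ?posrE ?expR_gt0// expRK.
  have : 0 <= c1 * k%:R by rewrite mulr_ge0.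
  have k0 : 0 <= k%:R :> R by []; lra.
pose U (N : {set 'I_p}) := sval (cid (orthonormal_cols X (N :|: M0))).
have UP N : [/\ orthonormal (U N), (size (U N) <= #|N :|: M0|)%N &
    forall (M' : {set 'I_p}) b, M' \subset N :|: M0 -> in_span (U N) (fit X M' b)].
  exact: svalP (cid (orthonormal_cols X (N :|: M0))).
have Lam0 : 0 <= Lam by apply: ln_ge0; have := gamma_gt0; lra.
(* Pays for the at most [k] dimensions that [M0] adds to each span. *)
pose A : R := k%:R * (Lam / 2).
have A0 : 0 <= A by rewrite mulr_ge0// divr_ge0.
have g0 := gamma_gt0; have g12 : 0 < gamma + 1 / 2 by lra.
have g34 : 0 < gamma + 3 / 4 by lra.
have g1 : 0 < gamma + 1 by lra.
have tas : 1 - 2 * (t / a) * s ^+ 2 = (4 * (1 + gamma))^-1.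
  by rewrite /t /a; field; apply/and4P; split; apply: lt0r_neq0 => //; lra.
have H := @selection_risk R _ Omega P n s eps _
  [pred N : {set 'I_p} | (#|N| < r)%N || (N == Ms)] U
  (fun N => Pen s gamma p r pi #|N|) (fitted X Mhat)
  (fit X M0 b0) (Pen s gamma p r pi k) a t A s_gt0 eps_normal mfit.
rewrite /risk bE; apply: le_trans (H _ _ _ _ _ _ _ _) _ => {H}.
- by rewrite /a divr_gt0//= ltr_pdivrMr//; lra.
- by rewrite /t divr_gt0//; apply: mulr_gt0 => //; exact: mulr_gt0.
- have : 0 < (4 * (1 + gamma))^-1 by rewrite invr_gt0 mulr_gt0// addr_gt0.
  by rewrite -tas subr_gt0.
- exact: Pen_ge0.
- exact: A0.
- by move=> N _; have [] := UP N.
- move=> y; have [Nr Nmin] := sel y.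
  have crit : normsq (y - fitted X Mhat y) + Pen s gamma p r pi #|Mhat y| <=
      normsq (y - fit X M0 b0) + Pen s gamma p r pi k.
    have := Nmin M0; rewrite cM0 => /(_ kr); rewrite /map_criterion cM0 => h.
    by apply: le_trans h _; rewrite lerD2r lse_min.
  have fE : fitted X Mhat y = fit X (Mhat y) (lse X (Mhat y) y) by exact: X_lse.
  have := Nr; rewrite leq_eqVlt => /orP[/eqP cN|cN].
    (* A saturated choice is replaced by [Ms], which carries the same fit and has the same
       penalty. *)
    have cMsN : #|Ms| = #|Mhat y| by rewrite cMs cN.
    exists Ms; split; [by rewrite /= eqxx orbT| |by rewrite cMsN].
    have [b' ->] : exists b', fitted X Mhat y = fit X Ms b' by exact: fit_saturated.
    have [_ _ spU] := UP Ms.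
    by apply: in_spanB; apply: spU; rewrite ?finset.subsetUl ?finset.subsetUr.
  exists (Mhat y); split => //; first by rewrite /= cN.
  rewrite fE; have [_ _ spU] := UP (Mhat y).
  by apply: in_spanB; apply: spU; rewrite ?finset.subsetUl ?finset.subsetUr.
- rewrite tas lnV ?posrE ?mulr_gt0 ?addr_gt0// opprK -/Lam.
  apply: (@le_trans _ _ (\sum_(N : {set 'I_p} | (#|N| < r)%N || (N == Ms)) pi #|N| / binr #|N|)).
    apply: ler_sum => N NQ.
    have Nr : (#|N| <= r)%N by case/orP: NQ => [/ltnW//|/eqP ->]; rewrite cMs.
    apply: le_trans (model_weight Nr); rewrite ler_expR.
    have [_ sz _] := UP N.
    have : (size (U N))%:R <= #|N|%:R + k%:R :> R.
      by rewrite -natrD ler_nat (leq_trans sz)// -cM0 leq_card_setU.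
    have Lam2 : 0 <= Lam / 2 by rewrite divr_ge0.
    move=> /(ler_wpM2r Lam2); rewrite /A; lra.
  rewrite (bigID (fun N : {set 'I_p} => (#|N| < r)%N))/=.
  rewrite (eq_bigl (fun N : {set 'I_p} => (#|N| < r)%N)); last first.
    by move=> N; rewrite andb_orl andbb; case: (N == Ms); rewrite ?andbT ?andbF ?orbF ?orbb.
  rewrite (sum_set_card _ _ (fun j => pi j / binr j)) (eq_bigl (pred1 Ms)); last first.
    move=> N; rewrite /= andb_orl andbN /=; case: eqP => // ->.
    by rewrite cMs ltnn.
  rewrite big_pred1_eq cMs {2}/binr ltnn divr1 -[leRHS]pi_prior.2 big_ord_recr/= lerD2r.
  apply: ler_sum => j _; rewrite card_ord {1}/binr ltn_ord mulrCA divff ?mulr1//.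
  by rewrite pnatr_eq0 -lt0n bin_gt0 (leq_trans (ltnW (ltn_ord j)) rp).
rewrite lee_fin Pen_ell// /C.
set G := 2 * (1 + 1 / gamma); set T := 2 * (gamma + 1) / (gamma + 1 / 2).
set rho := rate R p r p0 in k_le_rate ell_le *.
have -> : (2 * s ^+ 2 * (1 + 1 / gamma) * (ell k + k%:R / 2 * L) + A / t + 1 / t) / (1 - a) =
    (G * (ell k + k%:R / 2 * L) + (k%:R * (Lam / 2) + 1) * T) * (4 * (gamma + 3 / 4)) * s ^+ 2.
  rewrite /A /t /a /G /T; field.
  by do ?[apply/andP; split]; apply: lt0r_neq0 => //; lra.
rewrite [leRHS](_ : _ = (G * (1 + c1 + c2 + L) + (Lam / 2 + 1) * T) * rho *
  (4 * (gamma + 3 / 4)) * s ^+ 2); last by ring.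
apply: ler_wpM2r; first exact: ltW.
apply: ler_wpM2r; first by lra.
have G0 : 0 <= G.
  by rewrite /G mulr_ge0// addr_ge0// divr_ge0// ltW.
have T0 : 0 <= T by rewrite /T divr_ge0 ?(ltW g12)//; lra.
have Lr : k%:R / 2 * L <= L * rho by have := ler_wpM2r L_ge0 k_le_rate; have := mulr_ge0 (ler0n R k) L_ge0; lra.
have h1 : G * (ell k + k%:R / 2 * L) <= G * ((1 + c1 + c2 + L) * rho).
  by rewrite ler_wpM2l//; move: ell_le; lra.
have h2 : (k%:R * (Lam / 2) + 1) * T <= (Lam / 2 + 1) * rho * T.
  rewrite ler_wpM2r//; have Lam2 : 0 <= Lam / 2 by rewrite divr_ge0.
  by have := ler_wpM2r Lam2 k_le_rate; lra.
by move: h1 h2; lra.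
Qed.

End map_selector_risk.

(** * Minimax lower bound and the rates *)

Lemma max_risk_le_sparsity (R : realType) d (Omega : measurableType d)
  (P : probability Omega R) n p (eps : Omega -> 'cV[R]_n) (X : 'M[R]_(n, p))
  k p0 f : (k <= p0)%N -> (max_risk P eps X k f <= max_risk P eps X p0 f)%E.
Proof.
move=> kp0; apply: ge_ereal_sup => _ [b bk <-].
by apply: ereal_sup_ubound; exists b => //=; exact: leq_trans bk kp0.
Qed.

Lemma minimax_risk_ge (R : realType) d (Omega : measurableType d)
  (P : probability Omega R) n p (s : R) (eps : Omega -> 'cV[R]_n)
  (X : 'M[R]_(n, p)) (c : R) p0 :
  0 < s -> gaussian_noise P s eps -> 0 < c -> c <= tau X (\rank X) ->
  (2 <= \rank X)%N -> (0 < p0 <= \rank X)%N ->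
  ((c / 64 / 6 * s ^+ 2 * rate R p (\rank X) p0)%:E <= minimax_risk P eps X p0)%E.
Proof.
move=> s0 Ne c0 ctau r2 p0r; have rp := rank_leq_col X.
set r := \rank X in ctau r2 p0r rp *.
have [lo [hi [lo0 hi0 clohi eig]]] := tau_sparse_eigen c0 ctau.
(* Two signals differ in up to 2k entries, and [tau] at [r] controls supports of size at most [r];
   hence the cut at r/2. Rank at least 2 keeps [k] positive. *)
pose k := minn p0 r./2.
have k0 : (0 < k)%N by rewrite leq_min half_gt0 r2 andbT; case/andP: p0r.
have kr : (k + k <= r)%N.
  rewrite addnn (@leq_trans (r./2).*2)//; first by rewrite leq_double geq_minr.
  by rewrite -[leqRHS]odd_double_half leq_addl.
pose m := (p %/ k)%N.
have m2 : (1 < m)%N by rewrite leq_divRL// mul2n -addnn (leq_trans kr).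
have cardp : (#|{: 'I_k * 'I_m}| <= p)%N.
  by rewrite card_prod !card_ord mulnC leq_trunc_div.
pose cc (x : 'I_k * 'I_m) : 'I_p := widen_ord cardp (enum_rank x).
have cc_inj : injective cc.
  by move=> x y /(congr1 val)/= /val_inj/enum_rank_inj.
apply: le_ereal_inf_tmp => _ [f mf <-].
have upper i : normsq (X *m delta_mx i ord0) <= hi.
  have /andP[_] := eig (delta_mx i ord0) (leq_trans (eq_leq (norm0_delta R i)) (ltnW r2)).
  by rewrite normsq_delta mulr1.
have lower b : (norm0 b <= k + k)%N -> lo * normsq b <= normsq (X *m b).
  by move=> bk; have /andP[] := eig b (leq_trans bk kr).
apply: le_trans (max_risk_le_sparsity P eps X f (geq_minl p0 r./2)).
apply: le_trans (sparse_lower_bound s0 Ne m2 cc_inj lo0 hi0 lower upper mf).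
rewrite lee_fin.
have r2p : (2 <= r <= p)%N by rewrite r2 rp.
have := rate_le_blocks R r2p p0r; rewrite -/k -/m => rle.
have lnm : 0 <= ln m%:R :> R by rewrite ln_ge0// ler1n ltnW.
have s2 : 0 < s ^+ 2 by rewrite exprn_gt0.
apply: (@le_trans _ _ (c / 64 / 6 * s ^+ 2 * (6 * (k%:R * ln m%:R)))).
  apply: ler_wpM2l rle; apply: mulr_ge0; last exact: ltW.
  by rewrite !divr_ge0// ltW.
have -> : c / 64 / 6 * s ^+ 2 * (6 * (k%:R * ln m%:R)) =
  c * (s ^+ 2 * (k%:R * ln m%:R) / 64) by field.
have -> : lo / hi * s ^+ 2 * (k%:R * ln m%:R) / 64 =
  lo / hi * (s ^+ 2 * (k%:R * ln m%:R) / 64) by ring.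
apply: ler_wpM2r => //; rewrite divr_ge0//; apply: mulr_ge0; first exact: ltW.
exact: mulr_ge0.
Qed.

Theorem corollary1 (R : realType) (sigma : R) (p : nat -> nat)
  (X : forall n, 'M[R]_(n, p n))
  (d : nat -> measure_display) (Omega : forall n, measurableType (d n))
  (P : forall n, probability (Omega n) R)
  (eps : forall n, Omega n -> 'cV[R]_n) (c : R)
  (sigma_gt0 : 0 < sigma)
  (eps_normal : forall n, gaussian_noise (P n) sigma (eps n))
  (X_free : forall n, columns_free (X n))
  (rank_infty : \rank (X n) @[n --> \oo] --> \oo)
  (c_gt0 : 0 < c)
  (nearly_orthogonal : forall n, (0 < \rank (X n))%N ->
     c <= tau (X n) (\rank (X n))) :
  (exists C1 C2 : R, 0 < C1 /\ C1 <= C2 /\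
     exists r0 : nat, forall n, (r0 <= \rank (X n))%N ->
       forall p0 : nat, (1 <= p0 <= \rank (X n))%N ->
         ((C1 * sigma ^+ 2 * rate R (p n) (\rank (X n)) p0)%:E
            <= minimax_risk (P n) (eps n) (X n) p0)%E /\
         (minimax_risk (P n) (eps n) (X n) p0
            <= (C2 * sigma ^+ 2 * rate R (p n) (\rank (X n)) p0)%:E)%E)
  /\
  (forall (gamma : R) (pi : nat -> nat -> R) (c1 c2 : R), 0 < gamma ->
     (forall n, prior (\rank (X n)) (pi n)) ->
     (forall n, prior_upper gamma (p n) (\rank (X n)) (pi n)) ->
     c_gamma gamma < c1 -> c_gamma gamma < c2 ->
     (forall n, prior_lower c1 c2 (p n) (\rank (X n)) (pi n)) ->
     exists C : R, exists r0 : nat, forall n, (r0 <= \rank (X n))%N ->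
       forall Mhat : 'cV[R]_n -> {set 'I_(p n)},
         map_selector sigma gamma (X n) (pi n) Mhat ->
         forall p0 : nat, (1 <= p0 <= \rank (X n))%N ->
           (max_risk (P n) (eps n) (X n) p0 (fitted (X n) Mhat)
              <= C%:E * minimax_risk (P n) (eps n) (X n) p0)%E).
Proof.
have X_tau n : (2 <= \rank (X n))%N -> c <= tau (X n) (\rank (X n)).
  by move=> r2; apply: nearly_orthogonal; exact: ltnW.
split.
  (* The minimum with 48 secures the order of the two constants. *)
  exists (Num.min (c / 64 / 6) 48), 48; split.
    by rewrite lt_min ltr0n andbT !divr_gt0.
  split; first by rewrite ge_min lexx orbT.
  exists 2 => n r2 p0 p0r; split; last exact: minimax_risk_le.
  apply: le_trans (minimax_risk_ge sigma_gt0 (eps_normal n) c_gt0 (X_tau n r2) r2 p0r).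
  rewrite lee_fin ler_wpM2r//.
    rewrite le_min ler0n andbT mulr_ge0//; apply: addr_ge0 => //; apply: ln_ratio_ge0.
    by case/andP: p0r => -> /leq_trans; apply; exact: rank_leq_col.
  by rewrite ler_wpM2r ?sqr_ge0// ge_min lexx.
move=> gamma pi c1 c2 gamma_gt0 pi_prior pi_upper c1_gt c2_gt pi_lower.
have cg0 : 0 <= c_gamma gamma by rewrite /c_gamma mulr_ge0// sqr_ge0.
have c10 : 0 <= c1 by rewrite ltW// (le_lt_trans cg0).
have c20 : 0 <= c2 by rewrite ltW// (le_lt_trans cg0).
pose C := (2 * (1 + 1 / gamma) * (1 + c1 + c2 + ln (1 + gamma)) +
  (ln (4 * (1 + gamma)) / 2 + 1) * (2 * (gamma + 1) / (gamma + 1 / 2))) *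
  (4 * (gamma + 3 / 4)).
(* Dividing by the constant of the lower bound turns the rate into the minimax risk; the absolute
   value avoids a discussion of the sign of [C]. *)
exists (`|C| / (c / 64 / 6)), 2 => n r2 Mhat sel p0 p0r.
apply: le_trans (map_risk_le sigma_gt0 (eps_normal n) (X_free n) gamma_gt0
  (pi_prior n) (pi_upper n) c10 c20 (pi_lower n) sel p0r) _.
have q0 : 0 < c / 64 / 6 by rewrite !divr_gt0.
have rate0 : 0 <= rate R (p n) (\rank (X n)) p0.
  rewrite le_min ler0n andbT mulr_ge0//; apply: addr_ge0 => //; apply: ln_ratio_ge0.
  by case/andP: p0r => -> /leq_trans; apply; exact: rank_leq_col.
apply: (@le_trans _ _ ((`|C| / (c / 64 / 6))%:E *
    (c / 64 / 6 * sigma ^+ 2 * rate R (p n) (\rank (X n)) p0)%:E)%E).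
  rewrite -EFinM lee_fin -/C.
  have -> : `|C| / (c / 64 / 6) * (c / 64 / 6 * sigma ^+ 2 * rate R (p n) (\rank (X n)) p0) =
      `|C| * (sigma ^+ 2 * rate R (p n) (\rank (X n)) p0) by field; rewrite gt_eqF.
  by rewrite -mulrA ler_wpM2r ?ler_norm//; apply: mulr_ge0 => //; exact: sqr_ge0.
apply: lee_wpmul2l; first by rewrite lee_fin divr_ge0 ?(ltW q0).
exact: (minimax_risk_ge sigma_gt0 (eps_normal n) c_gt0 (X_tau n r2) r2 p0r).
Qed.
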